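(* The family $\{\bar H_\mu(\mathbf{x};q,t)\}_\mu$, indexed by all partitions $\mu$, of fully colored Macdonald polynomials is a linear basis of the algebra $\Lambda$ of symmetric functions over $\mathbb{Q}(q,t)$.
   Context: Diagrams: a partition $\lambda$ is identified with $\{(i,j):1\le j\le\ell(\lambda),1\le i\le\lambda_j\}$ (French convention, $i$ column, $j$ row); $\lambda^t$ is the conjugate; leg length of $(i,j)$ is $\lambda^t_i-j$. $\mu\oplus\nu=(\mu_1+\nu_1,\mu_2+\nu_2,\dots)$, $\lambda^B=\bigoplus_{b\in B}\lambda^b$. For a filling $\sigma:\lambda\to\mathbb{Z}_{>0}$: descents are boxes $(i,j+1)$ with $\sigma((i,j+1))>\sigma((i,j))$, $\mathrm{maj}(\sigma)=\sum_{\text{descents}}(\text{leg}+1)$; an inversion pair is a pair $(\square_1,\square_2)$ in one row, $\square_1$ strictly left of $\square_2$, such that with $\square_3$ directly below $\square_1$: $\sigma(\square_1)\le\sigma(\square_3)<\sigma(\square_2)$ or $\sigma(\square_3)<\sigma(\square_2)<\sigma(\square_1)$ or $\sigma(\square_2)<\sigma(\square_1)\le\sigma(\square_3)$ (in row 1, $\sigma(\square_3)$ is smaller than all entries); $\mathrm{inv}(\sigma)$ is their number. Modified Macdonald polynomials: $\tilde H_\lambda=\sum_{\sigma:\lambda\to\mathbb{Z}_{>0}}q^{\mathrm{inv}(\sigma)}t^{\mathrm{maj}(\sigma)}\prod_\square x_{\sigma(\square)}$. Macdonald cumulant of partitions $\lambda^1,\dots,\lambda^r$: $\kappa(\lambda^1,\dots,\lambda^r)=(q-1)^{1-r}\sum_{\pi}(-1)^{\#\pi-1}(\#\pi-1)!\prod_{B\in\pi}\tilde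 H_{\lambda^B}$, over set partitions $\pi$ of $[r]$. For a partition $\mu$, the fully colored Macdonald polynomial is $\bar H_\mu(\mathbf{x};q,t)=\kappa(1^{\mu^t_1},1^{\mu^t_2},\dots,1^{\mu^t_{\mu_1}})$, where $1^k$ denotes the one-column partition $(1,\dots,1)$ with $k$ parts. *)

(* Defs.v *)
From HB Require Import structures.
From mathcomp Require Import all_boot all_order all_fingroup all_algebra.
From mathcomp.multinomials Require Import mpoly.

Set Implicit Arguments.
Unset Strict Implicit.
Unset Printing Implicit Defensive.

Import GRing.Theory.
Local Open Scope ring_scope.

Definition is_part (s : seq nat) : bool := sorted geq s && (0%N \notin s).

Record intpart := IntPart {parts :> seq nat; _ : is_part parts}.

HB.instance Definition _ := [isSub for parts].
HB.instance Definition _ := [Countable of intpart by <:].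

Fact is_part_nil : is_part [::].
Proof. by []. Qed.

Definition empty_part : intpart := IntPart is_part_nil.

(* All indices are 0-based: la`_j is the part usually written la_(j+1). *)
Definition oplus_seq (la mu : seq nat) : seq nat :=
  mkseq (fun j => (nth 0 la j + nth 0 mu j)%N) (maxn (size la) (size mu)).

Lemma is_part_nth_homo (la : intpart) (j : nat) :
  (nth 0 la j.+1 <= nth 0 la j)%N.
Proof.
case: la => s /= /andP[s_sorted _].
have [lt_j | le_j] := ltnP j.+1 (size s); last by rewrite nth_default.
by have := sortedP 0%N s_sorted j lt_j.
Qed.

Lemma is_part_nth_gt0 (la : intpart) (j : nat) :
  (j < size la)%N -> (0 < nth 0 la j)%N.
Proof.
case: la => s /= /andP[_ s_pos] lt_j; rewrite lt0n.
by apply: contraNneq s_pos => <-; apply: mem_nth.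
Qed.

Fact oplus_subproof (la mu : intpart) : is_part (oplus_seq la mu).
Proof.
apply/andP; split.
  apply/(sortedP 0%N) => j; rewrite size_mkseq => lt_j.
  by rewrite !nth_mkseq ?(ltnW lt_j) //= leq_add ?is_part_nth_homo.
apply/negP => /mapP[j]; rewrite mem_iota add0n leq_max /= => lt_j /esym/eqP.
apply/negP; rewrite addn_eq0 negb_and -!lt0n.
by case/orP: lt_j => /is_part_nth_gt0 ->; rewrite ?orbT.
Qed.

Definition oplus (la mu : intpart) : intpart := IntPart (oplus_subproof la mu).

Fact column_subproof (k : nat) : is_part (nseq k 1%N).
Proof.
rewrite /is_part mem_nseq andbF andbT.
by apply/(sortedP 0%N) => j; rewrite size_nseq => lt_j; rewrite !nth_nseq lt_j (ltnW lt_j).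
Qed.

Definition column (k : nat) : intpart := IntPart (column_subproof k).

(* The parts of the conjugate partition, i.e. the heights of the columns. *)
Definition conj_part (la : seq nat) (i : nat) : nat :=
  count (fun l => i < l)%N la.

Notation Qqt := {fraction {mpoly rat[2]}}.

Definition qvar : Qqt := FracField.tofrac ('X_ord0 : {mpoly rat[2]}).
Definition tvar : Qqt := FracField.tofrac ('X_ord_max : {mpoly rat[2]}).

Definition box (la : seq nat) := {j : 'I_(size la) & 'I_(nth 0 la j)}.

Section Fillings.

Variables (n : nat) (la : intpart).

Implicit Types (b : box la).

Definition row b : nat := tag b.
Definition col b : nat := tagged b.

Definition leg b : nat := (conj_part la (col b) - (row b).+1)%N.

Definition below b : option (box la) :=
  [pick b' | (col b' == col b) && (row b == (row b').+1)].

(* The letter k : 'I_n stands for the positive integer k.+1. *)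
Variable sigma : {ffun box la -> 'I_n}.

Definition entry b : nat := (sigma b).+1.

(* Below the first row sits a virtual entry smaller than all entries. *)
Definition entry_below b : nat := oapp entry 0%N (below b).

Definition descent b : bool := below b && (entry_below b < entry b)%N.

Definition maj : nat := (\sum_(b | descent b) (leg b).+1)%N.

Definition inversion b1 b2 : bool :=
  let: (s1, s2, s3) := (entry b1, entry b2, entry_below b1) in
  [&& row b1 == row b2, (col b1 < col b2)%N &
      [|| (s1 <= s3 < s2)%N, (s3 < s2 < s1)%N | (s2 < s1 <= s3)%N]].

Definition inv : nat := #|[set bb : box la * box la | inversion bb.1 bb.2]|.

End Fillings.

(* A power series of bounded degree in x_1, x_2, ... is given by its
   restrictions to finitely many variables: the n-th component is obtained by
   setting x_(n+1) = x_(n+2) = ... = 0.  Sums, products and scalings are taken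
   componentwise. *)
Definition pseries := forall n : nat, {mpoly Qqt[n]}.

Definition kill_last (n : nat) (p : {mpoly Qqt[n.+1]}) : {mpoly Qqt[n]} :=
  p \mPo [tuple oapp (fun j : 'I_n => 'X_j) 0 (unlift ord_max i) | i < n.+1].

(* The algebra Lambda, as the inverse limit, in the category of graded
   algebras, of the rings of symmetric polynomials. *)
Definition symfun (f : pseries) : Prop :=
  [/\ forall n, f n \is symmetric,
      forall n, kill_last (f n.+1) = f n
    & exists d, forall n, (msize (f n) <= d)%N].

(* Setting x_(n+1) = x_(n+2) = ... = 0 leaves the fillings by 1, ..., n. *)
Definition macdonald (la : intpart) : pseries := fun n =>
  \sum_(sigma : {ffun box la -> 'I_n})
    (qvar ^+ inv sigma * tvar ^+ maj sigma) *: \prod_(b : box la) 'X_(sigma b).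

Lemma symfun1 : symfun (fun=> 1).
Proof.
split=> [n | n |]; first exact: rpred1; first by rewrite /kill_last rmorph1.
by exists 1%N => n; rewrite msize1.
Qed.

Lemma symfunZ (a : Qqt) (f : pseries) : symfun f -> symfun (fun n => a *: f n).
Proof.
move=> [f_sym f_lim [d f_d]]; split=> [n | n |].
- exact/rpredZ/f_sym.
- by rewrite -[in RHS]f_lim; apply: linearZ.
- by exists d => n; apply: leq_trans (msizeZ_le _ _) (f_d n).
Qed.

Lemma symfunD (f g : pseries) :
  symfun f -> symfun g -> symfun (fun n => f n + g n).
Proof.
move=> [f_sym f_lim [d f_d]] [g_sym g_lim [e g_e]]; split=> [n | n |].
- exact: (rpredD (f_sym n) (g_sym n)).
- by rewrite -[f n]f_lim -[g n]g_lim; apply: rmorphD.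
- exists (maxn d e) => n; apply: leq_trans (msizeD_le _ _) _.
  by rewrite geq_max !leq_max f_d g_e orbT.
Qed.

Lemma symfunM (f g : pseries) :
  symfun f -> symfun g -> symfun (fun n => f n * g n).
Proof.
move=> [f_sym f_lim [d f_d]] [g_sym g_lim [e g_e]]; split=> [n | n |].
- exact: (rpredM (f_sym n) (g_sym n)).
- by rewrite -[f n]f_lim -[g n]g_lim; apply: rmorphM.
- exists (d + e).+1 => n; apply: leq_trans (msizeM_le _ _) _.
  by rewrite ltnS leq_add.
Qed.

(* For r = 0 the truncated r.-1 and #|pi|.-1 make the empty cumulant 1. *)
Definition cumulant (r : nat) (la : 'I_r -> intpart) : pseries := fun n =>
  (qvar - 1) ^- r.-1 *:
    \sum_(pi : {set {set 'I_r}} | partition pi [set: 'I_r])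
      ((-1) ^+ #|pi|.-1 * (#|pi|.-1)`!%:R) *:
        \prod_(B in pi) macdonald (\big[oplus/empty_part]_(b in B) la b) n.

Definition colored_macdonald (mu : intpart) : pseries :=
  cumulant (fun i : 'I_(head 0%N mu) => column (conj_part mu i)).

Definition lincomb (I : Type) (h : I -> pseries) (c : I -> Qqt) (s : seq I) :
    pseries :=
  fun n => \sum_(i <- s) c i *: h i n.

Definition free_family (I : eqType) (h : I -> pseries) : Prop :=
  forall (s : seq I) (c : I -> Qqt), uniq s ->
    (forall n, lincomb h c s n = 0) -> forall i, i \in s -> c i = 0.

Definition linear_basis (I : eqType) (L : pseries -> Prop) (h : I -> pseries) :
    Prop :=
  [/\ forall i, L (h i),
      free_family h
    & forall f, L f ->
        exists (s : seq I) (c : I -> Qqt), forall n, f n = lincomb h c s n].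

(* Main.v *)
From HB Require Import structures.
From mathcomp Require Import all_boot all_order all_fingroup all_algebra.
From mathcomp Require Import zify ring.
From mathcomp.multinomials Require Import mpoly.
Require Import Defs.

(** Symmetry.  Comparing inversion triples with attacking pairs gives
    q^inv * t^maj = q^(number of attacking inversions) * (one factor per
    descent).  A factor a^[descent at b] is affine in q^[descent at b], so the
    modified Macdonald polynomial is a combination of unicellular LLT
    polynomials, for the attack relations enlarged by some of the pairs (box,
    box below).  These relations are interval-closed in the reading order.
    Exchanging two adjacent letters in such an LLT polynomial only involves the
    boxes carrying them, and the two-letter generating function satisfies a
    recursion on the last box whose coefficients are symmetric.

    Basis.  The transition matrix to the monomial symmetric functions of degree
    at most d has, up to powers of q - 1 in its rows, polynomial entries in q
    and t, so it is invertible as soon as its value at q = t = 0 is.  There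
    inv = maj = 0 forces the filling to increase along the reading order, hence
    the Macdonald polynomial of la becomes h_|la|, and the fully colored one of
    mu becomes, up to sign, (r-1)! times the product of the h_(mu^t_i), 1 <= i
    <= r, plus products of fewer h's.  A linear form vanishing on all of them
    vanishes on all products of h's, then by Newton's identities on all
    products of power sums, hence is zero: p_nu is a nonzero multiple of m_nu
    plus monomial functions with fewer parts. *)

Set Implicit Arguments.
Unset Strict Implicit.
Unset Printing Implicit Defensive.

Import Order.TTheory GRing.Theory Num.Theory.
Local Open Scope ring_scope.

(** * Two-letter fillings *)

Lemma sum_powerset_in (T : finType) (V : nmodType) (P : {set T}) (w : T)
    (F : {set T} -> V) : w \in P ->
  \sum_(S in powerset P | w \in S) F S = \sum_(S in powerset (P :\ w)) F (w |: S).
Proof.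
move=> wP; rewrite (reindex_onto (fun S => w |: S) (fun S => S :\ w)) /=; last first.
  by move=> S /andP[_ wS]; rewrite setD1K.
apply: eq_bigl => S; rewrite !powersetE setU11 andbT subUset sub1set wP subsetD1.
have [wS|wS] := boolP (w \in S); last by rewrite setU1K ?eqxx.
rewrite andbF; apply/negbTE/nandP; right; apply/eqP => /setP/(_ w).
by rewrite !inE wS eqxx.
Qed.

Lemma sum_powersetD1 (T : finType) (V : nmodType) (P : {set T}) (w : T)
    (F : {set T} -> V) : w \in P ->
  \sum_(S in powerset P) F S =
  \sum_(S in powerset (P :\ w)) F (w |: S) + \sum_(S in powerset (P :\ w)) F S.
Proof.
move=> wP; rewrite (bigID (fun S : {set T} => w \in S)) /= sum_powerset_in //.
by congr (_ + _); apply: eq_bigl => S; rewrite !powersetE subsetD1.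
Qed.

(** As [p] is injective, the number of elements of [A] above [w] takes each value from 0 to
    [#|A| - 1] exactly once, so the sum is geometric. The induction removes the smallest element,
    which has all the others above it. *)
Lemma exp_telescope (T : finType) (R : comNzRingType) (p : T -> nat) (q : R)
    (A : {set T}) : injective p ->
  q ^+ #|A| = 1 + (q - 1) * \sum_(w in A) q ^+ #|[set v in A | p w < p v]%N|.
Proof.
move=> p_inj; elim: {A}_.+1 {-2}A (ltnSn #|A|) => // k IH A; rewrite ltnS => leAk.
have [->|[a aA]] := set_0Vmem A; first by rewrite cards0 big_set0 mulr0 addr0.
pose w := [arg min_(w < a in A) p w].
have [wA w_min] : w \in A /\ {in A, forall v, p w <= p v}%N.
  by rewrite /w; case: arg_minnP => // w' ? ?; split.
have cA : #|A| = #|A :\ w|.+1 by rewrite (cardsD1 w) wA.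
rewrite (big_setD1 w) //= cA exprS.
have -> : [set v in A | p w < p v]%N = A :\ w.
  apply/setP => v; rewrite !inE andbC; apply: andb_id2r => vA.
  by rewrite ltn_neqAle w_min // andbT (inj_eq p_inj) eq_sym.
have := IH (A :\ w); rewrite -cA => /(_ leAk) IHA.
have -> : \sum_(i in A :\ w) q ^+ #|[set v in A | (p i < p v)%N]| =
   \sum_(i in A :\ w) q ^+ #|[set v in A :\ w | (p i < p v)%N]|.
  apply: eq_bigr => i; rewrite !inE => /andP[iw iA].
  congr (_ ^+ #|pred_of_set _|); apply/setP => v; rewrite !inE.
  have [->|//] := eqVneq v w; by rewrite ltnNge w_min ?andbF.
rewrite mulrDr addrCA -IHA //; ring.
Qed.

Section TwoLetters.

Variables (T : finType) (p : T -> nat) (E : rel T) (R : comNzRingType) (q : R).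
Hypothesis p_inj : injective p.
Hypothesis E_lt : forall u v, E u v -> (p u < p v)%N.
(** Such relations are the sets of cells under a Dyck path; they index the unicellular LLT
    polynomials. *)
Hypothesis E_interval : forall u v u' v', E u v ->
  (p u <= p u')%N -> (p u' < p v')%N -> (p v' <= p v)%N -> E u' v'.

Definition cut (A B : {set T}) : nat := (\sum_(u in A) \sum_(v in B) E u v)%N.

(** [S] is the set of boxes with the larger letter, of weight [x]: the inversions are then the pairs
    of [E] going from [S] to its complement. *)
Definition two_letter (x y : R) (P : {set T}) : R :=
  \sum_(S in powerset P) q ^+ cut S (P :\: S) * x ^+ #|S| * y ^+ #|P :\: S|.

Let above (w : T) (P : {set T}) : nat := #|[set v in P | p w < p v]%N|.

(* When m carries y, it is cut from its neighbours carrying x.  Writing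
   q^k = 1 + (q - 1) (1 + q + ... + q^(k-1)) singles out one such neighbour w,
   and each box between w and m then accounts for exactly one factor q, whatever
   its letter. *)
Lemma two_letter_rec (x y : R) (P : {set T}) (m : T) :
    m \in P -> {in P, forall v, p v <= p m}%N ->
  two_letter x y P = (x + y) * two_letter x y (P :\ m)
    + (q - 1) * (x * y) *
      \sum_(w in P :\ m | E w m) q ^+ above w (P :\ m) * two_letter x y (P :\ m :\ w).
Proof.
move=> mP m_max; rewrite /two_letter (sum_powersetD1 _ mP) mulrDl -addrA; congr (_ + _).
  (* [m] carries x: it comes last, so no pair of [E] starts at it and the cut does not change. *)
  rewrite mulr_sumr; apply: eq_bigr => S; rewrite powersetE subsetD1 => /andP[SP mS].
  have -> : P :\: (m |: S) = P :\ m :\: S by rewrite setDDl.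
  have -> : cut (m |: S) (P :\ m :\: S) = cut S (P :\ m :\: S).
    rewrite /cut big_setU1 //= big1 ?add0n // => v; rewrite !inE => /and3P[_ _ vP].
    by apply/eqP; rewrite eqb0; apply/negP => /E_lt; rewrite ltnNge m_max.
  by rewrite cardsU1 mS add1n exprS; ring.
pose A (S : {set T}) := [set u in S | E u m].
have cutE (S : {set T}) : S \in powerset (P :\ m) ->
    q ^+ cut S (P :\: S) * x ^+ #|S| * y ^+ #|P :\: S| =
    y * (q ^+ cut S (P :\ m :\: S) * x ^+ #|S| * y ^+ #|P :\ m :\: S|) +
    \sum_(w in P :\ m | E w m && (w \in S)) (q - 1) * y *
      (q ^+ (cut S (P :\ m :\: S) + #|[set v in A S | p w < p v]%N|) * x ^+ #|S| *
      y ^+ #|P :\ m :\: S|).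
  rewrite powersetE subsetD1 => /andP[SP mS].
  have mPS : m \in P :\: S by rewrite inE mS.
  have eqP' : (P :\: S) :\ m = P :\ m :\: S by rewrite !setDDl setUC.
  have -> : cut S (P :\: S) = (cut S (P :\ m :\: S) + #|A S|)%N.
    have -> : #|A S| = (\sum_(u in S) E u m)%N.
      rewrite -sum1_card big_mkcond [RHS]big_mkcond; apply: eq_bigr => u _.
      by rewrite inE; case: (u \in S) => //=; case: (E u m).
    rewrite /cut -big_split /=; apply: eq_bigr => u uS.
    by rewrite (big_setD1 m) //= eqP' addnC.
  rewrite (cardsD1 m (P :\: S)) mPS eqP' exprD (exp_telescope _ _ p_inj).
  rewrite [in RHS](eq_bigl (fun w => w \in A S)); last first.
    move=> w; rewrite /A !inE -andbA.
    apply/and4P/andP => [[_ _ -> ->]//|[wS Ewm]].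
    by split => //; [apply: contraNneq mS => <- | apply: (subsetP SP)].
  rewrite add1n exprS -mulr_sumr.
  under [in RHS]eq_bigr do rewrite exprD -!mulrA.
  by rewrite -mulr_sumr -mulr_suml; ring.
rewrite (eq_bigr _ cutE).
rewrite big_split /= -mulr_sumr; congr (_ + _).
rewrite (exchange_big_dep (fun w => (w \in P :\ m) && E w m)) /=; last first.
  by move=> S w _ /and3P[-> ->].
rewrite mulr_sumr; apply: eq_bigr => w /andP[wP Ewm].
under eq_bigl do rewrite wP Ewm /=.
rewrite sum_powerset_in // !mulr_sumr; apply: eq_bigr => S.
rewrite powersetE subsetD1 => /andP[SP wS].
have eqP' : P :\ m :\: (w |: S) = P :\ m :\ w :\: S by rewrite !setDDl setUA.
rewrite cardsU1 wS exprS eqP'.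
set c := (X in q ^+ X * _).
suff -> : c = (above w (P :\ m) + cut S (P :\ m :\ w :\: S))%N.
  by rewrite exprD; ring.
rewrite /c /cut big_setU1 //= addnAC addnC [in RHS]addnC; congr (_ + _)%N.
(* By interval closure from [E w m], every box of [P :\ m] after [w] is a neighbour of both [w] and
   [m]. It is counted by the cut of [w] if it carries y, and among the neighbours of [m] if it
   carries x. *)
have Ew v : v \in P :\ m -> E w v = (p w < p v)%N.
  rewrite !inE => /andP[_ vP]; apply/idP/idP => [/E_lt//|lt_wv].
  by apply: (E_interval Ewm) => //; apply: m_max.
have Em v : v \in P :\ m -> (p w < p v)%N -> E v m.
  rewrite !inE => /andP[vm vP] /ltnW le_wv; apply: (E_interval Ewm) => //.
  by rewrite ltn_neqAle (inj_eq p_inj) vm m_max.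
have cardE (B : {set T}) : #|[set v in B | p w < p v]%N| =
    (\sum_v ((v \in B) && (p w < p v)%N))%N.
  by rewrite -sum1_card big_mkcond; apply: eq_bigr => v _; rewrite inE; case: (_ && _).
rewrite /above !cardE big_mkcond -big_split; apply: eq_bigr => v _ /=.
rewrite !inE; have [->|vw] := eqVneq v w; first by rewrite ltnn !andbF.
rewrite /=; have [vS|vS] /= := boolP (v \in S).
  have := subsetP SP v vS; rewrite !inE => /andP[-> ->] /=.
  by have [lt_wv|] := ltnP (p w) (p v); rewrite ?andbF // Em // (subsetP SP).
have [vP|] /= := boolP ((v != m) && (v \in P));
  last by case: (v != m); rewrite //= => /negbTE ->.
by rewrite addn0 Ew // !inE.
Qed.

Lemma two_letter_sym (x y : R) (P : {set T}) : two_letter x y P = two_letter y x P.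
Proof.
elim: {P}_.+1 {-2}P (ltnSn #|P|) => // k IH P; rewrite ltnS => lePk.
have [->|[a aP]] := set_0Vmem P.
  rewrite /two_letter powerset0 !big_set1 setD0 cards0 !expr0; ring.
pose m := [arg max_(m > a in P) p m].
have [mP m_max] : m \in P /\ {in P, forall v, p v <= p m}%N.
  by rewrite /m; case: arg_maxnP => // m' ? ?; split.
have lt_m : (#|P :\ m| < k)%N by move: lePk; rewrite (cardsD1 m) mP.
rewrite !(two_letter_rec _ _ mP m_max) IH // [x + y]addrC [x * y]mulrC.
congr (_ + _ * _); apply: eq_bigr => w _; rewrite IH //.
by apply: leq_ltn_trans lt_m; rewrite subset_leq_card // subD1set.
Qed.

End TwoLetters.

(** * Unicellular LLT polynomials *)

Section LLT.

Variables (T : finType) (E : rel T) (R : comNzRingType) (q : R) (n : nat).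

Definition attacks (sigma : {ffun T -> 'I_n}) : nat :=
  (\sum_u \sum_v (E u v && (sigma v < sigma u)))%N.

(** The letters are given values [x] in an arbitrary ring, so that permuting them is composing [x]
    with a permutation. *)
Definition llt (x : 'I_n -> R) : R :=
  \sum_(sigma : {ffun T -> 'I_n}) q ^+ attacks sigma * \prod_b x (sigma b).

(** Fillings are grouped by the result [tau] of renaming [j] as [i]. No letter lies between the two,
    so comparisons with other letters are unaffected, and a filling over [tau] is determined by its
    set of boxes carrying [j]. *)
Lemma llt_collapse (x : 'I_n -> R) (i j : 'I_n) : j = i.+1 :> nat ->
  llt x = \sum_(tau : {ffun T -> 'I_n} | [forall b, tau b != j])
    q ^+ attacks tau * \prod_(b | tau b != i) x (tau b) *
    two_letter E q (x j) (x i) [set b | tau b == i].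
Proof.
move=> ij; have neq_ij : i != j by apply/eqP => e; move: ij; rewrite e; lia.
pose merge (sigma : {ffun T -> 'I_n}) := [ffun b => if sigma b == j then i else sigma b].
rewrite /llt (partition_big merge (fun tau => [forall b, tau b != j])) /=; last first.
  by move=> sigma _; apply/forallP => b; rewrite ffunE; case: ifPn.
apply: eq_bigr => tau /forallP tau_j; set P := [set b | tau b == i].
pose split_at (S : {set T}) := [ffun b => if b \in S then j else tau b].
rewrite (reindex_onto split_at (fun sigma => [set b | sigma b == j])) /=; last first.
  move=> sigma /eqP merge_sigma; apply/ffunP => b; rewrite !ffunE inE.
  have [->//|sb] := eqVneq (sigma b) j.
  by rewrite -merge_sigma ffunE (negbTE sb).
rewrite /two_letter mulr_sumr; apply: eq_big => [S|S].
  rewrite powersetE; apply/andP/subsetP => [[/eqP e _] b bS|SP].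
    by rewrite inE -e !ffunE bS eqxx.
  split; last first.
    by apply/eqP/setP => b; rewrite inE ffunE; case: ifP; rewrite ?eqxx ?(negbTE (tau_j b)).
  apply/eqP/ffunP => b; rewrite !ffunE; have [/SP|bS] := boolP (b \in S).
    by rewrite inE eqxx => /eqP.
  by rewrite (negbTE (tau_j b)).
case/andP=> /eqP merge_S /eqP S_def.
have SP b : b \in S -> tau b = i by rewrite -merge_S !ffunE => ->; rewrite eqxx.
have subSP : S \subset P by apply/subsetP => b /SP; rewrite inE => ->.
have attacksE : attacks (split_at S) = (attacks tau + cut E S (P :\: S))%N.
  rewrite /attacks /cut [X in (_ + X)%N]big_mkcond -big_split; apply: eq_bigr => u _ /=.
  rewrite [X in (_ + (if _ then X else _))%N]big_mkcond.
  have -> : (if u \in S then \sum_v (if v \in P :\: S then E u v : nat else 0) else 0)%N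
     = (\sum_v (if (u \in S) && (v \in P :\: S) then E u v : nat else 0))%N.
    by case: ifP => // _; rewrite big1.
  rewrite -big_split; apply: eq_bigr => v _ /=; rewrite !ffunE !inE.
  case: (E u v); rewrite ?if_same //=.
  have := tau_j u; have := tau_j v; have := ij.
  have [/SP ->|uS] := boolP (u \in S); have [/SP ->|vS] := boolP (v \in S);
    rewrite /= -!val_eqE /=.
  - by move=> *; rewrite !ltnn.
  - by move=> -> _ _; rewrite ltnS leq_eqVlt; case: eqP => [->|_]; rewrite ?ltnn ?addn0.
  - by rewrite addn0 => -> _ tu; congr nat_of_bool; lia.
  - by rewrite addn0.
have cardPS : \prod_(b in P :\: S) x (tau b) = x i ^+ #|P :\: S|.
  by rewrite -prodr_const; apply: eq_bigr => b; rewrite !inE => /andP[_ /eqP ->].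
have -> : \prod_b x (split_at S b) =
    \prod_(b | tau b != i) x (tau b) * (x j ^+ #|S| * x i ^+ #|P :\: S|).
  rewrite (bigID (fun b => b \in P)) /= mulrC; congr (_ * _).
    apply: eq_big => [b|b]; first by rewrite inE.
    by rewrite ffunE => bP; rewrite ifN //; apply: contraNN bP; apply: (subsetP subSP).
  rewrite (bigID (fun b => b \in S)) /= -cardPS -prodr_const; congr (_ * _).
    apply: eq_big => [b|b]; first by apply: andb_idl; apply: (subsetP subSP).
    by rewrite ffunE => /andP[_ ->].
  apply: eq_big => [b|b]; first by rewrite [in RHS]inE andbC.
  by rewrite ffunE => /andP[_ /negbTE ->].
by rewrite attacksE exprD; ring.
Qed.

Variable p : T -> nat.
Hypothesis p_inj : injective p.
Hypothesis E_lt : forall u v, E u v -> (p u < p v)%N.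
Hypothesis E_interval : forall u v u' v', E u v ->
  (p u <= p u')%N -> (p u' < p v')%N -> (p v' <= p v)%N -> E u' v'.

Lemma eq_llt (x y : 'I_n -> R) : x =1 y -> llt x = llt y.
Proof. by move=> eq_xy; apply: eq_bigr => s _; under eq_bigr do rewrite eq_xy. Qed.

Lemma llt_adjacent (x : 'I_n -> R) (i j : 'I_n) : j = i.+1 :> nat ->
  llt (x \o tperm i j) = llt x.
Proof.
move=> ij; rewrite !(llt_collapse _ ij); apply: eq_bigr => tau /forallP tau_j.
rewrite /= tpermL tpermR (two_letter_sym _ p_inj E_lt E_interval); congr (_ * _ * _).
by apply: eq_bigr => b tau_i; rewrite tpermD // eq_sym.
Qed.

Lemma llt_tperm (i j : 'I_n) (x : 'I_n -> R) : llt (x \o tperm i j) = llt x.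
Proof.
wlog lt_ij : i j / (i < j)%N => [IH|].
  case: (ltngtP i j) => [/IH//|lt_ji|/val_inj ->]; first by rewrite tpermC IH.
  by apply: eq_llt => k /=; rewrite tperm1 perm1.
elim: {j}(j - i.+1)%N {-2}j (erefl (j - i.+1)%N) lt_ij x => [|k IH] j def_k lt_ij x.
  by apply: llt_adjacent; lia.
have lt_j' : (j.-1 < n)%N by have := ltn_ord j; lia.
pose j' := Ordinal lt_j'.
have jj' : j = j'.+1 :> nat by rewrite /=; lia.
have lt_ij' : (i < j')%N by rewrite /=; lia.
have ij' : i != j by rewrite -val_eqE /=; lia.
have ij'' : i != j' by rewrite -val_eqE /=; lia.
(* Conjugating (i j-1) by the adjacent transposition (j-1 j) gives (i j), so three known invariances
   compose. *)
have -> : tperm i j = (tperm i j' ^ tperm j' j)%g.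
  by rewrite tpermJ tpermL tpermD // eq_sym.
rewrite conjgE tpermV -(llt_adjacent x jj') -(IH j' _ lt_ij' (x \o tperm j' j)); last first.
  by rewrite /=; lia.
rewrite -[RHS](llt_adjacent _ jj'); apply: eq_llt => l; rewrite /= !permM //.
Qed.

Lemma llt_perm (s : 'S_n) (x : 'I_n -> R) : llt (x \o s) = llt x.
Proof.
have [ts -> _] := prod_tpermP s; elim: ts x => [|t ts IH] x.
  by rewrite big_nil; apply: eq_llt => i; rewrite /= perm1.
rewrite big_cons -(IH x) -[RHS](llt_tperm t.1 t.2).
by apply: eq_llt => i; rewrite /= permM.
Qed.

End LLT.

(** * Macdonald polynomials in terms of LLT polynomials *)

Lemma leq_nth_part (la : intpart) (i j : nat) : (i <= j)%N ->
  (nth 0 la j <= nth 0 la i)%N.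
Proof.
move=> /subnKC <-; elim: (j - i)%N => [|k IH]; first by rewrite addn0.
by rewrite addnS; apply: leq_trans (is_part_nth_homo _ _) IH.
Qed.

Section Boxes.

Variable la : intpart.
Implicit Types b u v : box la.

Lemma box_inj b b' : row b = row b' -> col b = col b' -> b = b'.
Proof.
case: b b' => [i k] [i' k']; rewrite /row /col /= => /val_inj eq_i; subst i'.
by move/val_inj ->.
Qed.

Lemma box_exists (j c : nat) : (c < nth 0 la j)%N ->
  exists b : box la, row b = j /\ col b = c.
Proof.
move=> lt_c; have lt_j : (j < size la)%N.
  by rewrite ltnNge; apply: contraTN lt_c => ?; rewrite nth_default.
by exists (Tagged (fun j : 'I_(size la) => 'I_(nth 0 la j))
  (Ordinal lt_c : 'I_(nth 0 la (Ordinal lt_j)))).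
Qed.

Lemma col_lt b : (col b < nth 0 la (row b))%N.
Proof. exact: ltn_ord. Qed.

Lemma belowE b b' : (below b == Some b') = (col b' == col b) && (row b == (row b').+1).
Proof.
rewrite /below; case: pickP => [b0 /andP[/eqP c0 /eqP r0]|none]; last by rewrite none.
apply/eqP/andP => [[<-]|[/eqP c1 /eqP r1]]; first by rewrite c0 r0 !eqxx.
by congr Some; apply: box_inj; lia.
Qed.

Lemma below_exists b : (0 < row b)%N -> exists b', below b = Some b'.
Proof.
move=> row_gt0; have [|b' [rb' cb']] := @box_exists (row b).-1 (col b).
  by apply: leq_trans (col_lt b) (leq_nth_part _ _); lia.
by exists b'; apply/eqP; rewrite belowE cb' rb' eqxx /= prednK.
Qed.

Definition right_of b b' : bool := (row b == row b') && (col b < col b')%N.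

Definition arm b : nat := (\sum_b' right_of b b')%N.

Definition attack u v : bool :=
  right_of u v || (row u == (row v).+1) && (col v < col u)%N.

Definition attack_below (D : {set box la}) : rel (box la) :=
  fun u v => attack u v || (u \in D) && (below u == Some v).

(* Reading order: rows from top to bottom, each row from left to right. *)
Definition reading b : nat := ((size la - row b) * nth 0 la 0 + col b)%N.

(** The first row is the longest, so [reading] is a positional encoding in base [nth 0 la 0] and
    compares rows before columns. *)
Lemma reading_ltn u v :
  (reading u < reading v)%N = (row v < row u)%N || (right_of u v).
Proof.
have cu : (col u < nth 0 la 0)%N := leq_trans (col_lt u) (leq_nth_part _ (leq0n _)).
have cv : (col v < nth 0 la 0)%N := leq_trans (col_lt v) (leq_nth_part _ (leq0n _)).
have ru : (row u < size la)%N := ltn_ord (tag u).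
have rv : (row v < size la)%N := ltn_ord (tag v).
rewrite /reading /right_of; have [lt_vu|lt_uv|->] := ltngtP (row v) (row u).
- by apply/idP; rewrite /=; nia.
- by apply/idP/idP; rewrite /=; nia.
- by rewrite ltn_add2l ?eqxx.
Qed.

Lemma reading_inj : injective reading.
Proof.
move=> u v eq_uv; have := reading_ltn u v; have := reading_ltn v u.
rewrite eq_uv ltnn /right_of => /esym/norP[h1 h2] /esym/norP[h3 h4].
by apply: box_inj; move: h1 h2 h3 h4; lia.
Qed.

Lemma attack_below_lt D u v : attack_below D u v -> (reading u < reading v)%N.
Proof.
rewrite reading_ltn /attack_below belowE /attack.
case/orP=> [/orP[->|/andP[/eqP -> _]]|/and3P[_ _ /eqP ->]].
- by rewrite orbT.
- by rewrite ltnSn.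
- by rewrite ltnSn.
Qed.

(** The boxes attacked by [u] are those that follow it in reading order and precede the box below
    it; membership in [D] prolongs this run by that one box. The run of a later box never ends
    earlier, whatever [D] is. *)
Lemma attack_below_interval D u v u' v' : attack_below D u v ->
    (reading u <= reading u')%N -> (reading u' < reading v')%N ->
    (reading v' <= reading v)%N ->
  attack_below D u' v'.
Proof.
rewrite /attack_below !belowE.
rewrite leq_eqVlt (inj_eq reading_inj) => Euv /predU1P ltu.
rewrite reading_ltn => ltu'v'; rewrite leq_eqVlt (inj_eq reading_inj) => /predU1P ltv.
case: ltu => [equ|]; case: ltv => [eqv|]; rewrite ?reading_ltn.
- by rewrite -equ eqv.
- by subst u'; move: Euv ltu'v'; rewrite /attack /right_of; case: (u \in D); lia.
- by subst v'; move: Euv ltu'v'; rewrite /attack /right_of; case: (u \in D); case: (u' \in D); lia.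
- by move: Euv ltu'v'; rewrite /attack /right_of; case: (u \in D); case: (u' \in D); lia.
Qed.

Section Filling.

Variables (n : nat) (sigma : {ffun box la -> 'I_n}).

Lemma descentE b b' : below b = Some b' -> descent sigma b = (sigma b' < sigma b)%N.
Proof. by rewrite /descent /entry_below => ->. Qed.

Lemma descent_None b : below b = None -> descent sigma b = false.
Proof. by rewrite /descent => ->. Qed.

(** With s1, s2 the entries and s3 the one below s1, the inversion condition is [s2 < s1] +
    [s3 < s2] - [s3 < s1], where the last bracket is the descent at [b1]. In the first row the last
    two brackets are both 1 and cancel; the formula omits both. *)
Lemma inversionE b1 b2 : (inversion sigma b1 b2 + (right_of b1 b2 && descent sigma b1) =
  (right_of b1 b2 && (sigma b2 < sigma b1)) +
  \sum_w (right_of b1 b2 && (below b1 == Some w) && (sigma w < sigma b2)))%N.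
Proof.
rewrite /inversion /right_of; case: (row b1 == row b2) => /=; last by rewrite big1.
case: (col b1 < col b2)%N => /=; last by rewrite big1.
case def_w : (below b1) => [w|]; last first.
  rewrite descent_None // big1 // addn0 addn0; congr nat_of_bool.
  by rewrite /entry_below def_w /= /entry ltnS leqn0 andbF orbF.
rewrite (descentE def_w) (bigD1 w) //= eqxx /= big1 ?addn0; last first.
  by move=> i iw; rewrite (inj_eq Some_inj) eq_sym (negbTE iw).
rewrite /entry_below def_w /= /entry !ltnS.
move: (nat_of_ord (sigma b1)) (nat_of_ord (sigma b2)) (nat_of_ord (sigma w)) => x1 x2 x3.
by have [?|?] := leqP x1 x3; have [?|?] := leqP x2 x3; have [?|?] := leqP x1 x2 => /=; lia.
Qed.

(** Summing [inversionE] over all pairs, the descents at [b1] are counted once per box of its arm,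
    and the terms with [w] below [b1] become the attacking pairs in consecutive rows. *)
Lemma inv_attacks :
  (inv sigma + \sum_(b | descent sigma b) arm b = attacks attack sigma)%N.
Proof.
have -> : inv sigma = (\sum_b1 \sum_b2 inversion sigma b1 b2)%N.
  rewrite /inv -sum1_card pair_big big_mkcond; apply: eq_bigr => bb _.
  by rewrite inE; case: inversion.
have -> : (\sum_(b | descent sigma b) arm b =
    \sum_b1 \sum_b2 (right_of b1 b2 && descent sigma b1))%N.
  rewrite big_mkcond; apply: eq_bigr => b _; case: ifP => _; last first.
    by rewrite big1 // => b2 _; rewrite andbF.
  by apply: eq_bigr => b2 _; rewrite andbT.
rewrite -big_split /=; under eq_bigr do rewrite -big_split /=.
under eq_bigr do under eq_bigr do rewrite inversionE.
under eq_bigr do rewrite big_split /=.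
rewrite big_split /=.
have -> : (\sum_b1 \sum_b2 \sum_w
    (right_of b1 b2 && (below b1 == Some w) && (sigma w < sigma b2)%N) =
  \sum_u \sum_v ((row u == (row v).+1) && (col v < col u) && (sigma v < sigma u)))%N.
  rewrite exchange_big; apply: eq_bigr => u _; rewrite exchange_big; apply: eq_bigr => v _ /=.
  case: (sigma v < sigma u)%N; last by rewrite andbF big1 // => b1 _; rewrite andbF.
  rewrite andbT; under eq_bigr do rewrite andbT.
  have [/andP[/eqP ruv cvu]|nuv] := boolP (_ && _); last first.
    rewrite big1 // => b1 _; rewrite belowE /right_of; move: nuv; lia.
  (* Given [u] and [v], the only possible [b1] is the box just above [v]; it exists because the row
     of [u] extends beyond the column of [v]. *)
  have [|b [rb cb]] := @box_exists (row u) (col v); first exact: ltn_trans (col_lt u).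
  rewrite (bigD1 b) //= big1 ?addn0 => [|b1].
    by rewrite belowE /right_of rb cb eqxx cvu ruv !eqxx.
  rewrite belowE /right_of => nb; apply/eqP; rewrite eqb0; apply: contra nb.
  move=> /andP[/andP[/eqP rb1 _] /andP[/eqP cb1 _]].
  by apply/eqP/box_inj; lia.
rewrite -big_split; apply: eq_bigr => u _; rewrite -big_split; apply: eq_bigr => v _ /=.
by rewrite /attack /right_of; case: (sigma v < sigma u)%N; rewrite ?andbF ?andbT //; lia.
Qed.

Lemma attacks_below (D : {set box la}) : attacks (attack_below D) sigma =
  (attacks attack sigma + \sum_(b in D) descent sigma b)%N.
Proof.
rewrite /attacks [X in (_ + X)%N]big_mkcond -big_split; apply: eq_bigr => u _ /=.
have -> : (if u \in D then descent sigma u : nat else 0%N) =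
    (\sum_v ((u \in D) && (below u == Some v) && (sigma v < sigma u)%N))%N.
  case: (u \in D) => /=; last by rewrite big1.
  case def_w : (below u) => [w|]; last by rewrite descent_None // big1.
  rewrite (descentE def_w) (bigD1 w) //= eqxx big1 ?addn0 // => i iw.
  by rewrite (inj_eq Some_inj) eq_sym (negbTE iw).
rewrite -big_split; apply: eq_bigr => v _ /=.
rewrite /attack_below belowE /attack /right_of.
by case: (sigma v < sigma u)%N; rewrite ?andbF ?andbT //; case: (u \in D); lia.
Qed.

End Filling.

Section Hall.

Variables (R : comNzRingType) (q t : R) (n : nat).

(** The sum defining [macdonald], over any ring and with any parameters: this allows both permuting
    the letters and specialising q and t. *)
Definition hhl (x : 'I_n -> R) : R :=
  \sum_(sigma : {ffun box la -> 'I_n})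
     q ^+ inv sigma * t ^+ maj sigma * \prod_b x (sigma b).

Variables (q' s : R).
Hypotheses (qK : q * q' = 1) (sK : (q - 1) * s = 1).

(* [a ^+ d = (1 - b) + b * q ^+ d] for d = 0, 1 and [b = (a - 1) / (q - 1)], so
   that each descent weight is absorbed by an extra attacking pair. *)
Lemma hhl_llt :
  exists c : {set box la} -> R,
    forall x : 'I_n -> R, hhl x = \sum_(D : {set box la}) c D * llt (attack_below D) q x.
Proof.
(* By [inv_attacks], once inv is replaced by the number of attacking inversions, this is the weight
   left for a descent at [b]. *)
pose a b := q' ^+ arm b * t ^+ (leg b).+1.
pose be b := (a b - 1) * s.
exists (fun D : {set box la} => \prod_b (if b \in D then be b else 1 - be b)) => x.
under [RHS]eq_bigr do rewrite mulr_sumr.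
rewrite exchange_big; apply: eq_bigr => sigma _ /=.
have -> : q ^+ inv sigma * t ^+ maj sigma = q ^+ attacks attack sigma *
    \prod_b (be b * q ^+ descent sigma b + (1 - be b)).
  rewrite -inv_attacks exprD -mulrA; congr (_ * _).
  rewrite (eq_bigr (fun b => if descent sigma b then a b else 1)); last first.
    move=> b _; case: (descent sigma b); rewrite ?expr1 ?expr0; last by ring.
    have e : be b * (q - 1) = a b - 1 by rewrite /be -mulrA [s * _]mulrC sK mulr1.
    by transitivity (1 + be b * (q - 1)); [ring | rewrite e; ring].
  rewrite -big_mkcond /maj -!prodrXr /= big_split /= mulrA -big_split /=.
  rewrite [X in _ = X * _]big1 ?mul1r // => b _.
  by rewrite -exprMn qK expr1n.
(* In the expanded product, [D] is the set of boxes contributing the summand that contains the power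
   of q. *)
rewrite bigA_distr mulr_sumr mulr_suml; apply: eq_bigr => D _.
rewrite attacks_below exprD -prodrXr.
rewrite [X in _ * X * _](eq_bigr (fun b => (if b \in D then be b else 1 - be b) *
  (if b \in D then q ^+ descent sigma b else 1))); last first.
  by move=> b _; case: (b \in D); rewrite ?mulr1.
by rewrite big_split /= -big_mkcond /=; ring.
Qed.

Lemma hhl_perm (x : 'I_n -> R) (g : 'S_n) : hhl (x \o g) = hhl x.
Proof.
have [c hhlE] := hhl_llt; rewrite !hhlE; apply: eq_bigr => D _; congr (_ * _).
by apply: (llt_perm _ reading_inj (@attack_below_lt D) (@attack_below_interval D)).
Qed.

End Hall.

End Boxes.

(** * Membership in Lambda *)

Lemma eq_hhl (la : intpart) (R : comNzRingType) (q t : R) (n : nat) (x y : 'I_n -> R) :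
  x =1 y -> hhl la q t x = hhl la q t y.
Proof. by move=> eq_xy; apply: eq_bigr => s _; under eq_bigr do rewrite eq_xy. Qed.

Lemma rmorph_hhl (la : intpart) (R S : comNzRingType) (f : {rmorphism R -> S}) (q t : R)
    (n : nat) (x : 'I_n -> R) :
  f (hhl la q t x) = hhl la (f q) (f t) (f \o x).
Proof.
rewrite rmorph_sum; apply: eq_bigr => s _.
by rewrite !rmorphM !rmorphXn rmorph_prod.
Qed.

(** A filling using the last letter has a zero factor. The others are the fillings by the first n
    letters, with the same entries and hence the same statistics. *)
Lemma hhl_extend (la : intpart) (R : comNzRingType) (q t : R) (n : nat) (x : 'I_n -> R) :
  hhl la q t (fun i : 'I_n.+1 => oapp x 0 (unlift ord_max i)) = hhl la q t x.
Proof.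
pose avoids (sigma : {ffun box la -> 'I_n.+1}) := [forall b, sigma b != ord_max].
rewrite [LHS](bigID avoids) /= addrC big1 ?add0r; last first.
  move=> sigma /forallPn[b]; rewrite negbK => /eqP sb.
  by rewrite (bigD1 b) //= sb unlift_none /= mul0r mulr0.
pose up (s : {ffun box la -> 'I_n}) := [ffun b => lift ord_max (s b)].
have up_inj : injective up.
  by move=> s s' /ffunP e; apply/ffunP => b; have := e b; rewrite !ffunE => /lift_inj.
rewrite (reindex_omap up (fun sigma => [pick s | up s == sigma])) /=; last first.
  move=> sigma /forallP nmax; case: pickP => [s /eqP <- //|none].
  have [s def_s] : exists s : box la -> 'I_n, forall b, lift ord_max (s b) = sigma b.
    pose Q b (j : 'I_n) := lift ord_max j = sigma b.
    apply: (@fin_all_exists _ _ Q) => b; have := nmax b; rewrite eq_sym => /unlift_some[j e _].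
    by exists j; rewrite /Q e.
  by have /negP[] := none (finfun s); apply/eqP/ffunP => b; rewrite !ffunE.
apply: eq_big => [s|s _].
  rewrite (_ : avoids _); last first.
    by apply/forallP => b; rewrite ffunE eq_sym neq_lift.
  case: pickP => [s' /eqP/up_inj ->|/(_ s)]; by rewrite eqxx.
have entry_up : entry (up s) =1 entry s by move=> b; rewrite /entry ffunE lift_max.
have below_up : entry_below (up s) =1 entry_below s.
  by move=> b; rewrite /entry_below; case: (below b) => //= b'; apply: entry_up.
congr (q ^+ _ * t ^+ _ * _).
- apply: eq_card => bb; rewrite !inE /inversion !entry_up !below_up; reflexivity.
- by apply: eq_bigl => b; rewrite /descent entry_up below_up.
- by apply: eq_bigr => b _; rewrite ffunE liftK.
Qed.

Lemma card_box (la : intpart) : #|{: box la}| = sumn la.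
Proof.
rewrite card_tagged !sumnE big_map big_enum (big_nth 0%N) big_mkord.
by apply: eq_bigr => i _; rewrite card_ord.
Qed.

Lemma qvar_neq0 : qvar != 0.
Proof.
rewrite /qvar tofrac_eq0. apply/eqP => /(congr1 (mcoeff U_(ord0))).
by rewrite mcoeffXU mcoeff0 eqxx => /eqP; rewrite oner_eq0.
Qed.

Lemma qvar1_neq0 : qvar - 1 != 0.
Proof.
rewrite /qvar -tofrac1 -tofracB tofrac_eq0.
apply/eqP => /(congr1 (mcoeff U_(ord0))).
by rewrite mcoeffB mcoeff1 mcoeffXU mcoeff0 eqxx mnm1_eq0 subr0 => /eqP; rewrite oner_eq0.
Qed.

Lemma macdonaldE (la : intpart) (n : nat) :
  macdonald la n = hhl la qvar%:MP tvar%:MP (fun i : 'I_n => 'X_i).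
Proof. by apply: eq_bigr => s _; rewrite -mul_mpolyC mpolyCM !rmorphXn. Qed.

Lemma msym_mpolyX (R : nzRingType) (n : nat) (s : 'S_n) (i : 'I_n) :
  msym s ('X_i : {mpoly R[n]}) = 'X_(s i).
Proof.
rewrite msymX; congr ('X_[_]); apply/mnmP => j; rewrite mnmE !mnm1E.
by rewrite (canF_eq (permK s)).
Qed.

Lemma msym_mpolyC (R : nzRingType) (n : nat) (s : 'S_n) (c : R) :
  msym s (c%:MP_[n]) = c%:MP.
Proof. by rewrite -[c%:MP]mulr1 mul_mpolyC msymZ msym1. Qed.

Lemma macdonald_sym (la : intpart) (n : nat) : macdonald la n \is symmetric.
Proof.
apply/issymP => s; rewrite macdonaldE.
rewrite (rmorph_hhl _ (msym s : {rmorphism {mpoly Qqt[n]} -> {mpoly Qqt[n]}})) /= !msym_mpolyC.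
pose X (i : 'I_n) : {mpoly Qqt[n]} := 'X_i.
rewrite -[RHS](@hhl_perm la _ qvar%:MP tvar%:MP n qvar^-1%:MP (qvar - 1)^-1%:MP _ _ X s).
- by apply: eq_hhl => i; rewrite /= msym_mpolyX.
- by rewrite -mpolyCM divff ?qvar_neq0.
- have -> : qvar%:MP_[n] - 1 = (qvar - 1)%:MP by rewrite mpolyCB mpolyC1.
  by rewrite -mpolyCM divff ?qvar1_neq0.
Qed.

Lemma macdonald_kill_last (la : intpart) (n : nat) :
  kill_last (macdonald la n.+1) = macdonald la n.
Proof.
rewrite !macdonaldE /kill_last -[RHS]hhl_extend.
set lq := [tuple _ | _ < _].
rewrite (rmorph_hhl _ (comp_mpoly lq : {rmorphism _ -> _})) /= !comp_mpolyC.
apply: eq_hhl => i /=.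
by rewrite comp_mpolyXU -tnth_nth tnth_mktuple.
Qed.

Lemma macdonald_msize (la : intpart) (n : nat) :
  (msize (macdonald la n) <= (sumn la).+1)%N.
Proof.
apply: leq_trans (msize_sum _ _ _) _; apply/bigmax_leqP => s _.
apply: leq_trans (msizeZ_le _ _) _; rewrite mprodXE msizeX ltnS mdeg_sum.
by under eq_bigr do rewrite mdeg1; rewrite sum1_card card_box.
Qed.

(** The part of Lambda of degree at most [d], [msize] being the degree plus one. Linear algebra
    takes place in these finite-dimensional pieces. *)
Definition symfun_le (d : nat) (f : pseries) : Prop :=
  [/\ forall n, f n \is symmetric, forall n, kill_last (f n.+1) = f n
    & forall n, (msize (f n) <= d.+1)%N].

Lemma symfun_leW (d : nat) (f : pseries) : symfun_le d f -> symfun f.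
Proof. by case=> ? ? ?; split=> //; exists d.+1. Qed.

Lemma symfun_leT (d e : nat) (f : pseries) : (d <= e)%N -> symfun_le d f -> symfun_le e f.
Proof. by move=> de [? ? fd]; split=> // n; apply: leq_trans (fd n) _. Qed.

Lemma symfun_le_ext (d : nat) (f g : pseries) :
  (forall n, f n = g n) -> symfun_le d f -> symfun_le d g.
Proof. by move=> fg [? ? ?]; split=> n; rewrite -?fg. Qed.

Lemma symfun_leD (d : nat) (f g : pseries) :
  symfun_le d f -> symfun_le d g -> symfun_le d (fun n => f n + g n).
Proof.
move=> Ff Fg; have [f_sym f_kill f_d] := Ff; have [g_sym g_kill g_d] := Fg.
have [s k _] := symfunD (symfun_leW Ff) (symfun_leW Fg).
split=> // n; apply: leq_trans (msizeD_le _ _) _.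
by rewrite geq_max f_d g_d.
Qed.

Lemma symfun_leZ (d : nat) (a : Qqt) (f : pseries) :
  symfun_le d f -> symfun_le d (fun n => a *: f n).
Proof.
move=> Ff; have [f_sym f_kill f_d] := Ff; have [s k _] := symfunZ a (symfun_leW Ff).
by split=> // n; apply: leq_trans (msizeZ_le _ _) (f_d n).
Qed.

Lemma symfun_leM (d e : nat) (f g : pseries) :
  symfun_le d f -> symfun_le e g -> symfun_le (d + e) (fun n => f n * g n).
Proof.
move=> Ff Fg; have [f_sym f_kill f_d] := Ff; have [g_sym g_kill g_d] := Fg.
have [s k _] := symfunM (symfun_leW Ff) (symfun_leW Fg).
split=> // n; have [->|f0] := eqVneq (f n) 0; first by rewrite mul0r msize0.
have [->|g0] := eqVneq (g n) 0; first by rewrite mulr0 msize0.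
rewrite msizeM // -subn1; apply: leq_trans (leq_sub2r 1 (leq_add (f_d n) (g_d n))) _.
by lia.
Qed.

Lemma symfun_le1 : symfun_le 0 (fun=> 1).
Proof. by have [s k _] := symfun1; split=> // n; rewrite msize1. Qed.

Lemma symfun_le0 (d : nat) : symfun_le d (fun=> 0).
Proof.
apply: (@symfun_leT 0) => //; apply: symfun_le_ext (symfun_leZ 0 symfun_le1) => n.
by rewrite scale0r.
Qed.

Lemma symfun_le_sum (d : nat) (I : Type) (r : seq I) (P : pred I) (F : I -> pseries) :
  (forall i, P i -> symfun_le d (F i)) ->
  symfun_le d (fun n => \sum_(i <- r | P i) F i n).
Proof.
move=> symF; elim: r => [|i r IH].
  by apply: symfun_le_ext (symfun_le0 d) => n; rewrite big_nil.
have [Pi|nPi] := boolP (P i).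
  by apply: symfun_le_ext (symfun_leD (symF i Pi) IH) => n; rewrite big_cons Pi.
by apply: symfun_le_ext IH => n; rewrite big_cons (negbTE nPi).
Qed.

Lemma symfun_le_prod (I : Type) (r : seq I) (P : pred I) (d : I -> nat) (F : I -> pseries) :
  (forall i, P i -> symfun_le (d i) (F i)) ->
  symfun_le (\sum_(i <- r | P i) d i) (fun n => \prod_(i <- r | P i) F i n).
Proof.
move=> symF; elim: r => [|i r IH].
  by rewrite big_nil; apply: symfun_le_ext symfun_le1 => n; rewrite big_nil.
rewrite big_cons; have [Pi|nPi] := boolP (P i).
  by apply: symfun_le_ext (symfun_leM (symF i Pi) IH) => n; rewrite big_cons Pi.
by apply: symfun_le_ext IH => n; rewrite big_cons (negbTE nPi).
Qed.

Lemma sumn_nth (s : seq nat) (N : nat) : (size s <= N)%N ->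
  sumn s = (\sum_(i < N) nth 0 s i)%N.
Proof.
move=> leN; rewrite sumnE (big_nth 0%N) -(big_mkord xpredT (fun i => nth 0 s i)).
rewrite [RHS](big_cat_nat (leq0n _) leN) //= [X in (_ + X)%N]big_nat_cond.
by rewrite [X in (_ + X)%N]big1 ?addn0 // => i /andP[/andP[? _] _]; rewrite nth_default.
Qed.

Lemma sumn_oplus (la mu : intpart) : sumn (oplus la mu) = (sumn la + sumn mu)%N.
Proof.
rewrite /= /oplus_seq sumnE big_map -{1}[maxn _ _]subn0 big_mkord.
by rewrite big_split !(@sumn_nth _ (maxn (size la) (size mu))) ?leq_maxl ?leq_maxr.
Qed.

Lemma sumn_big_oplus (I : Type) (r : seq I) (P : pred I) (F : I -> intpart) :
  sumn (\big[oplus/empty_part]_(i <- r | P i) F i) = (\sum_(i <- r | P i) sumn (F i))%N.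
Proof.
by apply: (big_morph (fun la : intpart => sumn la)) => // la mu; apply: sumn_oplus.
Qed.

Lemma sumn_column (k : nat) : sumn (column k) = k.
Proof. by rewrite /= sumn_nseq mul1n. Qed.

Lemma sum_conj_part (la : intpart) : (\sum_(i < head 0 la) conj_part la i)%N = sumn la.
Proof.
rewrite /conj_part; under eq_bigr do rewrite -sum1_count big_mkcond.
rewrite exchange_big sumnE big_seq [RHS]big_seq; apply: eq_bigr => l l_la /=.
have le_l : (l <= head 0 la)%N.
  by rewrite -nth0 -(nth_index 0%N l_la); apply: leq_nth_part.
rewrite -big_mkcond /= -(big_mkord (fun i => i < l)%N (fun=> 1%N)).
by rewrite -(big_nat_widen 0 l _ xpredT (fun=> 1%N)) // sum_nat_const_nat subn0 muln1.
Qed.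

(** Sizes are additive under [oplus] and the blocks of a set partition cover each index once, so
    every product in the cumulant satisfies the same degree bound. *)
Lemma cumulant_symfun_le (r : nat) (la : 'I_r -> intpart) :
  symfun_le (\sum_i sumn (la i)) (cumulant la).
Proof.
apply: symfun_leZ; apply: symfun_le_sum => pi /and3P[/eqP cov triv _].
apply: symfun_leZ.
rewrite (eq_bigl (fun i => i \in [set: 'I_r])); last by move=> i; rewrite inE.
rewrite -cov big_trivIset //; apply: symfun_le_prod => B _; split=> n.
- exact: macdonald_sym.
- exact: macdonald_kill_last.
- by rewrite -sumn_big_oplus; apply: macdonald_msize.
Qed.

Lemma colored_symfun_le (mu : intpart) : symfun_le (sumn mu) (colored_macdonald mu).
Proof.
rewrite -sum_conj_part; apply: symfun_leT (cumulant_symfun_le _).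
by under eq_bigr do rewrite sumn_column.
Qed.

(** * Coefficients and the value at q = t = 0 *)

Lemma widen_lift (n : nat) (i : 'I_n) : widen_ord (leqnSn n) i = lift ord_max i.
Proof. by apply: val_inj; rewrite /= /bump leqNgt ltn_ord. Qed.

Lemma mcoeff_kill_last (n : nat) (p : {mpoly Qqt[n.+1]}) (m : 'X_{1..n}) :
  (kill_last p)@_m = p@_(mnmwiden m).
Proof.
rewrite /kill_last comp_mpolyEX [in RHS](mpolyE p) !raddf_sum /=.
apply: eq_bigr => k _; rewrite !mcoeffZ mcoeffX; congr (_ * _).
rewrite comp_mpolyX big_ord_recr /= tnth_mktuple unlift_none /= expr0n.
under eq_bigr => i _ do rewrite tnth_mktuple widen_lift liftK /=.
pose k' := [multinom k (lift ord_max i) | i < n].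
have -> : \prod_(i < n) ('X_i : {mpoly Qqt[n]}) ^+ k (lift ord_max i) = 'X_[k'].
  by rewrite [RHS]mpolyXE_id; apply: eq_bigr => i _; rewrite mnmE.
rewrite mulr_natr raddfMn /= mcoeffX -mulrnA mulnb; congr ((nat_of_bool _)%:R).
apply/andP/eqP => [[/eqP <- /eqP k0]|eq_k].
  apply/mnmP => i; have [j ->|->] := unliftP ord_max i.
    by rewrite -widen_lift mnmwiden_widen mnmE widen_lift.
  by rewrite mnmwiden_ordmax.
rewrite eq_k mnmwiden_ordmax eqxx; split=> //; apply/eqP/mnmP => i.
by rewrite mnmE eq_k -widen_lift mnmwiden_widen.
Qed.

(** For a partition [s] with at most [n] parts, the coefficient of this monomial in a symmetric
    polynomial is its coordinate on the monomial symmetric function m_s. *)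
Definition mnm_of (n : nat) (s : seq nat) : 'X_{1..n} := [multinom nth 0%N s i | i < n].

Lemma mnm_of_widen (n : nat) (s : seq nat) : (size s <= n)%N ->
  mnm_of n.+1 s = mnmwiden (mnm_of n s).
Proof.
move=> le_n; apply/mnmP => i; have [j ->|->] := unliftP ord_max i.
  by rewrite -widen_lift mnmwiden_widen !mnmE.
by rewrite mnmwiden_ordmax mnmE nth_default.
Qed.

Lemma mcoeff_stable (f : pseries) (s : seq nat) (n N : nat) :
    (forall n, kill_last (f n.+1) = f n) -> (size s <= n)%N -> (n <= N)%N ->
  (f N)@_(mnm_of N s) = (f n)@_(mnm_of n s).
Proof.
move=> f_kill le_n /subnKC <-; elim: (N - n)%N => [|k IH]; first by rewrite addn0.
rewrite addnS -IH -(f_kill (n + k)%N) mcoeff_kill_last -mnm_of_widen //.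
by apply: leq_trans le_n (leq_addr _ _).
Qed.

Fact shape_subproof (s : seq nat) : is_part (sort geq [seq k <- s | k != 0%N]).
Proof.
apply/andP; split; first by apply: sort_sorted => x y; apply: leq_total.
by rewrite mem_sort mem_filter eqxx.
Qed.

Definition shape_of (s : seq nat) : intpart := IntPart (shape_subproof s).

Lemma perm_shape_of (s : seq nat) : perm_eq (shape_of s) [seq k <- s | k != 0%N].
Proof. by rewrite perm_sort. Qed.

Lemma sumn_shape_of (s : seq nat) : sumn (shape_of s) = sumn s.
Proof.
rewrite (perm_sumn (perm_shape_of s)); elim: s => //= k s <-; by case: k.
Qed.

Lemma size_part (la : intpart) : (size la <= sumn la)%N.
Proof.
case: la => s /= /andP[_]; elim: s => //= k s IH; rewrite inE negb_or => /andP[k0 /IH].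
by move: k0; rewrite eq_sym; lia.
Qed.

Lemma mnm_of_cat (la : seq nat) (n : nat) : (size la <= n)%N ->
  (mnm_of n la : seq nat) = la ++ nseq (n - size la) 0%N.
Proof.
move=> le_n; apply: (@eq_from_nth _ 0%N) => [|i].
  by rewrite size_cat size_nseq size_tuple subnKC.
rewrite size_tuple => lt_i; rewrite -[LHS](mnm_nth _ _ (Ordinal lt_i)) mnmE /=.
rewrite nth_cat; case: ltnP => // le_i; rewrite nth_default // nth_nseq.
by case: ifP.
Qed.

Lemma mperm_shape_of (n : nat) (m : 'X_{1..n}) :
  exists s : 'S_n, mnm_of n (shape_of m) = [multinom m (s i) | i < n].
Proof.
have : perm_eq (mnm_of n (shape_of m)) m.
  have le_n : (size (shape_of m) <= n)%N.
    rewrite (perm_size (perm_shape_of m)) size_filter.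
    by rewrite (leq_trans (count_size _ _)) ?size_tuple.
  rewrite mnm_of_cat //.
  have -> : nseq (n - size (shape_of m)) 0%N = [seq k <- m | ~~ (k != 0%N)].
    apply/esym; rewrite (perm_size (perm_shape_of m)) -[X in (X - _)%N](size_tuple m).
    rewrite -(count_predC (fun k => k != 0%N) m) size_filter addKn -size_filter.
    by apply/all_pred1P; apply/allP => k; rewrite mem_filter negbK => /andP[].
  apply: (@perm_trans _ ([seq k <- m | k != 0%N] ++ [seq k <- m | ~~ (k != 0%N)])).
    by rewrite perm_cat2r perm_shape_of.
  by apply/permPl; apply: perm_filterC.
case/tuple_permP => s def_s; exists s; apply/mnmP => i; rewrite [RHS]mnmE.
rewrite (mnm_nth 0%N) def_s -tnth_nth tnth_mktuple; exact: mnm_tnth.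
Qed.

(** By symmetry each coefficient equals one at a sorted exponent. A partition of size at most [d]
    has at most [d] parts, so [d] variables are enough to see its coefficient. *)
Lemma symfun_le_eq0 (d : nat) (f : pseries) : symfun_le d f ->
    (forall la : intpart, (sumn la <= d)%N -> (f d)@_(mnm_of d la) = 0) ->
  forall n, f n = 0.
Proof.
move=> [f_sym f_kill f_d] f0 n; apply/mpolyP => m; rewrite mcoeff0.
have [le_d|lt_d] := leqP (mdeg m) d; last first.
  by apply: memN_msupp_eq0; apply: msize_mdeg_ge; apply: leq_trans (f_d n) lt_d.
have le_shape : (sumn (shape_of m) <= d)%N by rewrite sumn_shape_of sumnE.
have size_n : (size (shape_of m) <= n)%N.
  rewrite (perm_size (perm_shape_of m)) size_filter.
    by rewrite (leq_trans (count_size _ _)) ?size_tuple.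
have [s def_s] := mperm_shape_of m.
have /issymP/(_ s) <- := f_sym n; rewrite mcoeff_sym -def_s.
(* The coefficient is moved from [n] up to [maxn n d] variables, then down to [d]. *)
rewrite -(mcoeff_stable f_kill size_n (leq_maxl n d)).
rewrite (@mcoeff_stable f _ d) ?leq_maxr //; first exact: f0.
exact: leq_trans (size_part _) le_shape.
Qed.

(** Multinomials of bounded degree form a finite type, and every partition of size at most [d] is
    the shape of one in [d] variables. *)
Definition parts_le (d : nat) : seq intpart :=
  filter (fun la : intpart => sumn la <= d)%N
    (undup [seq shape_of m | m : 'X_{1..d < d.+1}]).

Lemma parts_le_uniq (d : nat) : uniq (parts_le d).
Proof. by rewrite filter_uniq // undup_uniq. Qed.

Lemma part_eq (la mu : intpart) : perm_eq la mu -> la = mu.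
Proof.
move=> pe; apply: val_inj; have [] := (valP la, valP mu) => /andP[sla _] /andP[smu _].
apply: (sorted_eq _ _ sla smu pe) => [y x z|x y] /=; rewrite /geq /=.
  by move=> yx zy; apply: leq_trans zy yx.
by rewrite andbC => /anti_leq.
Qed.

Lemma shape_of_part (la : intpart) (n : nat) : (size la <= n)%N -> shape_of (mnm_of n la) = la.
Proof.
move=> le_n; apply: part_eq; apply: perm_trans (perm_shape_of _) _.
rewrite mnm_of_cat // filter_cat.
have /all_filterP -> : all (fun k => k != 0%N) la.
  by apply/allP => k k_la; apply: contraTneq k_la => ->; case: la {le_n} => s /= /andP[].
by rewrite (_ : [seq k <- nseq _ _ | _] = [::]) ?cats0 //; elim: (n - _)%N.
Qed.

Lemma mem_parts_le (d : nat) (la : intpart) : (la \in parts_le d) = (sumn la <= d)%N.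
Proof.
rewrite mem_filter mem_undup andbC; apply: andb_idl => le_d.
have size_d := leq_trans (size_part la) le_d.
have lt_d : (mdeg (mnm_of d la) < d.+1)%N.
  by rewrite /mdeg -sumnE mnm_of_cat // sumn_cat sumn_nseq addn0.
apply/imageP; exists (BMultinom lt_d) => //.
by rewrite -[LHS](shape_of_part size_d).
Qed.

Section Specialization.

Variable R : comNzRingType.

(** The complete homogeneous polynomial h_k: [basis n k] consists of the weakly increasing words of
    length k, one for each monomial of degree k. *)
Definition hsym (n k : nat) : {mpoly R[n]} :=
  \sum_(t in basis n k) 'X_[s2m t].

Lemma mcoeff_hsym (n k : nat) (m : 'X_{1..n}) : (hsym n k)@_m = (mdeg m == k)%:R.
Proof.
rewrite /hsym raddf_sum basis_cover /= -big_enum /=.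
under eq_bigr do rewrite mcoeffX.
rewrite -(big_map (fun t : k.-tuple 'I_n => s2m t) xpredT (fun m' => (m' == m)%:R)).
have [m_in|m_notin] := boolP (m \in _).
  rewrite (bigD1_seq m) ?uniq_basis //= eqxx big1 ?addr0 // => m' /negbTE -> //.
rewrite big_seq big1 // => m' m'_in; case: eqP => // eq_m.
by rewrite -eq_m m'_in in m_notin.
Qed.

Definition in_order (la : intpart) (n : nat) (sigma : {ffun box la -> 'I_n}) : bool :=
  [forall u, forall v, (reading u < reading v)%N ==> (sigma u <= sigma v)%N].

Lemma maj_eq0 (la : intpart) (n : nat) (sigma : {ffun box la -> 'I_n}) :
  (maj sigma == 0%N) = [forall b, ~~ descent sigma b].
Proof.
rewrite /maj sum_nat_eq0; apply: eq_forallb => b.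
by case: (descent sigma b).
Qed.

(** Without descents, inv counts the attacking inversions. If both vanish, the filling increases
    weakly along attacking pairs and from each box to the one below; chains of such steps link any
    two boxes in reading order. *)
Lemma inv_maj_eq0 (la : intpart) (n : nat) (sigma : {ffun box la -> 'I_n}) :
  (inv sigma == 0%N) && (maj sigma == 0%N) = in_order sigma.
Proof.
have inv0 : [forall b, ~~ descent sigma b] -> (inv sigma = attacks (@attack la) sigma).
  move=> /forallP nodesc; rewrite -inv_attacks big1 ?addn0 // => b desc.
  by have := nodesc b; rewrite desc.
rewrite maj_eq0; apply/andP/forallP => [[inv_eq0 nodesc]|order].
  have le_attack u v : attack u v -> (sigma u <= sigma v)%N.
    move: inv_eq0; rewrite inv0 // /attacks sum_nat_eq0 => /forallP/(_ u) /=.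
    rewrite sum_nat_eq0 => /forallP/(_ v) /= + Euv; rewrite Euv eqb0 -leqNgt //.
  have le_below u v : below u = Some v -> (sigma u <= sigma v)%N.
    by move=> uv; have := forallP nodesc u; rewrite (descentE _ uv) -leqNgt.
  move=> u; apply/forallP => v; rewrite reading_ltn; apply/implyP.
  elim: {u}(row u - row v)%N {-2}u (erefl (row u - row v)%N) => [|k IH] u.
    by move=> def_k /orP[|ruv]; [lia | apply: le_attack; rewrite /attack ruv].
  move=> def_k _; have [|w uw] := @below_exists _ u; first by lia.
  have := uw => /eqP; rewrite belowE => /andP[/eqP cw /eqP rw].
  (* Either [u] attacks [v] in the next row, or the box [w] below [u] is still not past [v] and the
     induction on the row gap continues from it. *)
  have [/andP[/eqP k0 cvu]|far] := boolP ((k == 0%N) && (col v < col u)%N).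
    by apply: le_attack; rewrite /attack cvu andbT; apply/orP; right; lia.
  apply: leq_trans (le_below u w uw) _.
  have [->//|nwv] := eqVneq w v.
  have {}nwv : ~~ ((row w == row v) && (col w == col v)).
    by apply: contra nwv => /andP[/eqP ? /eqP ?]; apply/eqP/box_inj.
  by apply: IH; [lia | rewrite /right_of; move: far nwv; lia].
have le u v : (reading u < reading v)%N -> (sigma u <= sigma v)%N.
  by move: (order u) => /forallP/(_ v)/implyP.
have nodesc : [forall b, ~~ descent sigma b].
  apply/forallP => b; case def_b' : (below b) => [b'|]; last by rewrite descent_None.
  rewrite (descentE _ def_b') -leqNgt le //.
  by move/eqP: def_b'; rewrite belowE reading_ltn => /andP[_ /eqP ->]; rewrite ltnSn.
split=> //; rewrite inv0 // /attacks big1 // => u _; rewrite big1 // => v _.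
apply/eqP; rewrite eqb0 negb_and -implybE; apply/implyP => uv; rewrite -leqNgt le //.
by apply: (@attack_below_lt _ set0); rewrite /attack_below uv.
Qed.

(** As 0 ^+ 0 = 1, exactly the fillings with inv = maj = 0 survive, each with coefficient 1. Read
    along the boxes they are the weakly increasing words of length |la|. *)
Lemma hhl00 (la : intpart) (n : nat) :
  hhl la 0 0 (fun i : 'I_n => 'X_i : {mpoly R[n]}) = hsym n (sumn la).
Proof.
pose e := sort (relpre (@reading la) leq) (enum {: box la}).
have e_mem b : b \in e by rewrite mem_sort mem_enum.
have e_uniq : uniq e by rewrite sort_uniq enum_uniq.
have size_e : size e = sumn la by rewrite size_sort -cardE card_box.
have e_sorted : sorted (relpre (@reading la) leq) e.
  by apply: sort_sorted => x y; apply: leq_total.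
pose te : (sumn la).-tuple (box la) := Tuple (introT eqP size_e).
have lt_idx b : (index b e < sumn la)%N by rewrite -size_e index_mem.
pose idx b : 'I_(sumn la) := Ordinal (lt_idx b).
have idxK b : tnth te (idx b) = b by rewrite (tnth_nth b) nth_index.
have teK i : idx (tnth te i) = i.
  by apply: val_inj; rewrite /= (tnth_nth (tnth te i)) index_uniq // size_e.
pose up (sigma : {ffun box la -> 'I_n}) := [tuple of map sigma te].
pose down (t : (sumn la).-tuple 'I_n) := [ffun b => tnth t (idx b)].
rewrite /hhl /hsym (bigID (@in_order la n)) /= addrC big1 ?add0r; last first.
  move=> sigma; rewrite -inv_maj_eq0 !expr0n -natrM mulnb => /negbTE ->.
  by rewrite mul0r.
rewrite [RHS](reindex_onto up down) /=; last first.
  by move=> t _; apply: eq_from_tnth => i; rewrite tnth_map ffunE teK.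
apply: eq_big => [sigma|sigma order].
  have -> : down (up sigma) = sigma by apply/ffunP => b; rewrite ffunE tnth_map idxK.
  rewrite eqxx andbT inE -map_comp sorted_map.
  have up_sorted : in_order sigma ->
      {in e &, forall u v, (reading u <= reading v)%N -> (sigma u <= sigma v)%N}.
    move=> order u v _ _; rewrite leq_eqVlt => /predU1P[/reading_inj -> //|].
    by move: order => /forallP/(_ u)/forallP/(_ v)/implyP.
  apply/idP/idP => [order|sorted_up].
    by apply: (sub_in_sorted (up_sorted order)) e_sorted; apply/allP.
  apply/forallP => u; apply/forallP => v; apply/implyP => lt_uv.
  have lt_index : (index u e < index v e)%N.
    rewrite ltnNge; apply: contraTN lt_uv => le_vu; rewrite -leqNgt.
    apply: (sorted_leq_index _ _ e_sorted) le_vu => // [x y z|x] /=.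
      exact: leq_trans.
    exact: leqnn.
  by apply: (sorted_ltn_index _ sorted_up) lt_index => // x y z; apply: leq_trans.
move: (order); rewrite -inv_maj_eq0 => /andP[/eqP -> /eqP ->].
rewrite !expr0 !mul1r mprodXE; congr ('X_[_]); apply/mnmP => i.
rewrite mnmE mnm_sumE count_map -sum1_count [RHS]big_mkcond [RHS]big_uniq //=.
apply: eq_big => [b|b _]; first by rewrite e_mem.
by rewrite mnm1E; case: eqP.
Qed.

End Specialization.

(** * Cumulants at q = t = 0 *)

Definition psum (R : comNzRingType) (n a : nat) : {mpoly R[n]} := \sum_(j < n) 'X_j ^+ a.

Lemma mcoeff_Xn_mul (R : comNzRingType) (n a : nat) (j : 'I_n)
    (p : {mpoly R[n]}) (m : 'X_{1..n}) :
  ('X_j ^+ a * p)@_m = if (a <= m j)%N then p@_(m - U_(j) *+ a) else 0.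
Proof.
rewrite mpolyXn mulrC; case: ifPn => [le_a|lt_a].
  rewrite -{1}[m](@submK _ (U_(j) *+ a)%MM); last first.
    by apply/mnm_lepP => i; rewrite mulmnE mnm1E; case: eqP => [<-|_]; rewrite ?mul1n.
  by rewrite addmC mcoeffMX.
apply: memN_msupp_eq0; rewrite (perm_mem (msuppMX _ _)); apply: contra lt_a.
case/mapP => m' _ ->; rewrite mnmDE mulmnE mnm1E eqxx mul1n; exact: leq_addr.
Qed.

(** For |m| = k, the product with power sum index i+1 and variable j contributes to the coefficient
    of x^m exactly when i < m_j; there are |m| = k such pairs. *)
Lemma newton_hsym (R : comNzRingType) (n k : nat) :
  k%:R *: hsym R n k = \sum_(i < k) psum R n i.+1 * hsym R n (k - i.+1).
Proof.
apply/mpolyP => m; rewrite mcoeffZ mcoeff_hsym raddf_sum /=.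
have coefE (i : 'I_k) : (psum R n i.+1 * hsym R n (k - i.+1))@_m =
    ((\sum_(j < n) (i < m j)) * (mdeg m == k))%:R.
  rewrite /psum mulr_suml raddf_sum /= big_distrl natr_sum; apply: eq_bigr => j _.
  rewrite mcoeff_Xn_mul; case: ltnP => le_i /=; last by rewrite mul0n.
  rewrite mcoeff_hsym mul1n.
  have le_m : (m j <= mdeg m)%N by rewrite mdegE (bigD1 j) //= leq_addr.
  have : mdeg m = (mdeg (m - U_(j) *+ i.+1)%MM + i.+1)%N.
    rewrite -[X in (_ + X)%N](mul1n i.+1) -(mdeg1 j) -mdegMn -mdegD submK //.
    by apply/mnm_lepP => l; rewrite mulmnE mnm1E; case: eqP => [<-|_]; rewrite ?mul1n.
  by move=> def_m; have lt_ik := ltn_ord i; congr ((nat_of_bool _)%:R); lia.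
under eq_bigr do rewrite coefE.
rewrite -natr_sum -big_distrl exchange_big -natrM; congr (_%:R).
case: eqP => [def_k|]; last by move=> _; rewrite /= !muln0.
rewrite /= !muln1 -def_k mdegE; apply: eq_bigr => j _ /=.
have le_m : (m j <= mdeg m)%N by rewrite mdegE (bigD1 j) //= leq_addr.
rewrite -mdegE -(big_mkord xpredT (fun i => (i < m j)%N : nat)).
rewrite (big_cat_nat (leq0n _) le_m) /= [X in (_ + X)%N]big_nat_cond.
rewrite [X in (_ + X)%N]big1 => [|i /andP[/andP[le_i _] _]]; last by rewrite ltnNge le_i.
rewrite big_nat (eq_bigr (fun=> 1%N)) => [|i /= ->//].
by rewrite -big_nat sum_nat_const_nat subn0 muln1 addn0.
Qed.

Section Cumulant.

Variables (R : comNzRingType) (q t : R) (n : nat) (x : 'I_n -> R).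
Variables (r : nat) (la : 'I_r -> intpart).

(* The cumulant without its factor (q - 1)^(1-r). *)
Definition raw_cumulant : R :=
  \sum_(pi : {set {set 'I_r}} | partition pi [set: 'I_r])
    ((-1) ^+ #|pi|.-1 * (#|pi|.-1)`!%:R) *
      \prod_(B in pi) hhl (\big[oplus/empty_part]_(b in B) la b) q t x.

End Cumulant.

Lemma rmorph_raw_cumulant (R S : comNzRingType) (f : {rmorphism R -> S}) (q t : R)
    (n : nat) (x : 'I_n -> R) (r : nat) (la : 'I_r -> intpart) :
  f (raw_cumulant q t x la) = raw_cumulant (f q) (f t) (f \o x) la.
Proof.
rewrite rmorph_sum; apply: eq_bigr => pi _.
rewrite !rmorphM rmorphXn rmorphN1 rmorph_nat rmorph_prod; congr (_ * _).
by apply: eq_bigr => B _; rewrite rmorph_hhl.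
Qed.

Lemma eq_raw_cumulant (R : comNzRingType) (q t : R)
    (n : nat) (x y : 'I_n -> R) (r : nat) (la : 'I_r -> intpart) : x =1 y ->
  raw_cumulant q t x la = raw_cumulant q t y la.
Proof.
move=> eq_xy; apply: eq_bigr => pi _; congr (_ * _).
by apply: eq_bigr => B _; apply: eq_hhl.
Qed.

Lemma cumulantE (r : nat) (la : 'I_r -> intpart) (n : nat) :
  cumulant la n = (qvar - 1) ^- r.-1 *:
    raw_cumulant qvar%:MP tvar%:MP (fun i : 'I_n => 'X_i) la.
Proof.
congr (_ *: _); apply: eq_bigr => pi _; rewrite -mul_mpolyC; congr (_ * _).
  by rewrite rmorphM rmorphXn rmorphN1 rmorph_nat.
by apply: eq_bigr => B _; rewrite macdonaldE.
Qed.

Lemma raw_cumulant00 (R : comNzRingType) (n : nat) (r : nat) (la : 'I_r -> intpart) :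
  raw_cumulant 0 0 (fun i : 'I_n => 'X_i : {mpoly R[n]}) la =
  \sum_(pi : {set {set 'I_r}} | partition pi [set: 'I_r])
    ((-1) ^+ #|pi|.-1 * (#|pi|.-1)`!%:R) *:
      \prod_(B in pi) hsym R n (\sum_(b in B) sumn (la b)).
Proof.
apply: eq_bigr => pi _; rewrite -mul_mpolyC; congr (_ * _).
  by rewrite rmorphM rmorphXn rmorphN1 rmorph_nat.
by apply: eq_bigr => B _; rewrite hhl00 sumn_big_oplus.
Qed.

Definition discrete (T : finType) : {set {set T}} := [set [set i] | i in [set: T]].

Lemma partition_discrete (T : finType) : partition (discrete T) [set: T].
Proof.
apply/and3P; split.
- apply/eqP/setP => i; rewrite inE; apply/bigcupP; exists [set i]; rewrite ?inE //.
  by apply/imsetP; exists i.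
- apply/trivIsetP => _ _ /imsetP[i _ ->] /imsetP[j _ ->] ij.
  by rewrite disjoints1 inE; apply: contra ij => /eqP ->.
- by apply/imsetP => -[i _ /setP/(_ i)]; rewrite !inE eqxx.
Qed.

Lemma card_discrete (T : finType) : #|discrete T| = #|T|.
Proof. by rewrite card_imset ?cardsT //; apply: set1_inj. Qed.

(** Blocks are nonempty and their sizes add up to [#|T|], so [#|T|] or more of them must be
    singletons. *)
Lemma card_partition_lt (T : finType) (pi : {set {set T}}) :
  partition pi [set: T] -> pi != discrete T -> (#|pi| < #|T|)%N.
Proof.
move=> part_pi; apply: contraNltn => le_T.
have sumT := card_partition part_pi; rewrite cardsT in sumT.
have pos B : B \in pi -> (0 < #|B|)%N.
  move=> B_pi; rewrite card_gt0; apply: contraTneq B_pi => ->.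
  by case/and3P: part_pi.
have one B : B \in pi -> #|B| = 1%N.
  move=> B_pi; apply/eqP; rewrite eqn_leq pos // andbT leqNgt; apply/negP => gt1.
  move: le_T; rewrite sumT (bigD1 B) //= leqNgt => /negP[].
  have -> : #|pi| = (1 + \sum_(B' in pi | B' != B) 1)%N by rewrite -sum1_card (bigD1 B).
  rewrite -addSn leq_add //.
  by apply: leq_sum => B' /andP[/pos].
rewrite eqEcard card_discrete le_T andbT; apply/subsetP => B B_pi.
have /cards1P[i ->] : #|B| == 1%N by rewrite one.
by apply/imsetP; exists i.
Qed.

Lemma ltn_conj_part (la : intpart) (i j : nat) :
  (i < conj_part la j)%N = (j < nth 0%N la i)%N.
Proof.
case: la => s /= /andP[s_sorted _]; rewrite /conj_part.
elim: s i s_sorted => [|l s IH] [|i] //= s_path.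
- have [lt_jl|le_lj] := ltnP j l; first by [].
  rewrite add0n; apply/negbTE; rewrite -eqn0Ngt -leqn0 leqNgt -has_count.
  apply/hasPn => k k_s; rewrite -leqNgt; apply: leq_trans le_lj.
  have ge_trans : transitive geq by move=> x y z /= xy zx; apply: leq_trans zx xy.
  by have /allP/(_ k k_s) := order_path_min ge_trans s_path.
- rewrite -IH ?(path_sorted s_path) //.
  have [lt_jl|le_lj] := ltnP j l; first by rewrite add1n ltnS.
  have -> : count (fun k => j < k)%N s = 0%N.
    apply/eqP; rewrite -leqn0 leqNgt -has_count; apply/hasPn => k k_s.
    rewrite -leqNgt; apply: leq_trans le_lj.
    have ge_trans : transitive geq by move=> x y z /= xy zx; apply: leq_trans zx xy.
    by have /allP/(_ k k_s) := order_path_min ge_trans s_path.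
  by [].
Qed.

Fact conj_subproof (la : intpart) : is_part (mkseq (conj_part la) (head 0%N la)).
Proof.
apply/andP; split.
  apply/(sortedP 0%N) => j; rewrite size_mkseq => lt_j.
  rewrite !nth_mkseq ?(ltnW lt_j) //= /geq /= leqNgt ltn_conj_part -leqNgt.
  by rewrite ltnW // ltnNge -ltn_conj_part ltnn.
apply/negP => /mapP[j]; rewrite mem_iota add0n -nth0 /= => lt_j /esym/eqP.
by rewrite -leqn0 leqNgt ltn_conj_part lt_j.
Qed.

(** Used to find, for each product of h's, the colored Macdonald polynomial whose leading term it is
    at q = t = 0. *)
Lemma conj_exists (la : intpart) : exists mu : intpart,
  [/\ sumn mu = sumn la, head 0%N mu = size la
    & forall i, conj_part mu i = nth 0%N la i].
Proof.
have head0 : conj_part la 0 = size la.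
  rewrite /conj_part -[RHS](count_predT la); apply: eq_in_count => l l_la.
  by rewrite -(nth_index 0%N l_la) is_part_nth_gt0 // index_mem.
have nth_conj i : nth 0%N (mkseq (conj_part la) (head 0%N la)) i = conj_part la i.
  have [lt_i|le_i] := ltnP i (head 0%N la); first by rewrite nth_mkseq.
  rewrite nth_default ?size_mkseq //; apply/esym/eqP.
  by rewrite -leqn0 leqNgt ltn_conj_part nth0 -leqNgt.
exists (IntPart (conj_subproof la)); split.
- by rewrite -(sum_conj_part la) sumnE /= /mkseq big_map -{1}[head _ _]subn0 big_mkord.
- by rewrite -nth0 nth_conj.
- move=> i; apply/eqP; rewrite eqn_leq; apply/andP; split; rewrite leqNgt.
    by rewrite ltn_conj_part nth_conj ltn_conj_part ltnn.
  rewrite -(ltn_conj_part la) -nth_conj -[nth _ _ _]/(nth 0%N (IntPart (conj_subproof la)) _).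
  by rewrite -ltn_conj_part ltnn.
Qed.

Section Kernel.

(** [W] stands for the kernel of a linear form that vanishes on all the cumulants at q = t = 0. *)
Variables (d : nat) (W : {mpoly rat[d]} -> Prop).
Hypothesis W0 : W 0.
Hypothesis WD : forall p p', W p -> W p' -> W (p + p').
Hypothesis WZ : forall c p, W p -> W (c *: p).
Hypothesis W_cumulant : forall mu : intpart, (sumn mu <= d)%N ->
  W (raw_cumulant 0 0 (fun i : 'I_d => 'X_i : {mpoly rat[d]})
       (fun i : 'I_(head 0%N mu) => column (conj_part mu i))).

Lemma W_sum (I : Type) (r : seq I) (P : pred I) (F : I -> {mpoly rat[d]}) :
  (forall i, P i -> W (F i)) -> W (\sum_(i <- r | P i) F i).
Proof. by move=> WF; apply: big_ind. Qed.

Lemma hsym0 (R : comNzRingType) (n : nat) : hsym R n 0 = 1.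
Proof. by apply/mpolyP => m; rewrite mcoeff_hsym mcoeff1 mdeg_eq0. Qed.

(** Induction on the number of factors: the discrete set partition gives the wanted product with a
    nonzero coefficient, and every other one gives a product of fewer h's of the same total
    degree. *)
Lemma W_hsym (s : seq nat) : (sumn s <= d)%N -> W (\prod_(a <- s) hsym rat d a).
Proof.
elim: {s}_.+1 {-2}s (ltnSn (size s)) => // k IH s; rewrite ltnS => size_s sum_s.
(* Since h_0 = 1, dropping zeros and sorting does not change the product. *)
set nu := shape_of s.
have -> : \prod_(a <- s) hsym rat d a = \prod_(a <- nu) hsym rat d a.
  rewrite (perm_big _ (perm_shape_of s)) big_filter [RHS]big_mkcond.
  by apply: eq_bigr => a _; case: eqP => // ->; rewrite hsym0.
have size_nu : (size nu <= k)%N.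
  by apply: leq_trans size_s; rewrite (perm_size (perm_shape_of s)) size_filter count_size.
have sum_nu : (sumn nu <= d)%N by rewrite sumn_shape_of.
have [mu [sum_mu head_mu conj_mu]] := conj_exists nu.
have := W_cumulant; move/(_ mu); rewrite sum_mu => /(_ sum_nu).
rewrite raw_cumulant00 (bigD1 (discrete _)) ?partition_discrete //=.
set rest := \sum_(pi | _) _; set lead := \prod_(B in _) _; set c := (_ * _).
have -> : lead = \prod_(a <- nu) hsym rat d a.
  rewrite /lead big_imset => [|i j _ _]; last exact: set1_inj.
  rewrite (big_nth 0%N) big_mkord -head_mu; apply: eq_big => [i|i _]; first by rewrite inE.
  by rewrite big_set1 sumn_column conj_mu.
have c_neq0 : c != 0.
  by rewrite /c mulf_neq0 ?signr_eq0 // pnatr_eq0 -lt0n fact_gt0.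
have W_rest : W rest.
  apply: W_sum => pi /andP[part_pi pi_neq]; apply: WZ.
  pose deg (B : {set 'I_(head 0%N mu)}) := (\sum_(b in B) sumn (column (conj_part mu b)))%N.
  rewrite -big_enum /= -(big_map deg xpredT (hsym rat d)).
  apply: IH.
    rewrite size_map -cardE; apply: leq_trans (card_partition_lt part_pi pi_neq) _.
    by rewrite card_ord head_mu.
  rewrite sumnE big_map big_enum /=.
  case/and3P: part_pi => /eqP cov triv _; rewrite -big_trivIset // cov.
  rewrite (eq_bigl xpredT) => [|i]; last by rewrite inE.
  by under eq_bigr do rewrite sumn_column; rewrite sum_conj_part sum_mu.
move=> W_all; rewrite -[\prod_(a <- nu) _](scalerK c_neq0); apply: WZ.
by rewrite -[c *: _](addrK rest); apply: WD => //; rewrite -scaleN1r; apply: WZ.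
Qed.

(** Newton's identity trades the first power sum p_a for a h_a minus the products p_i h_(a-i) with 0
    < i < a. As the indices are positive, this lowers the total index of the power sums, on which
    the induction runs. *)
Lemma W_psum (s s' : seq nat) : all (fun a => 0 < a)%N s -> (sumn s + sumn s' <= d)%N ->
  W (\prod_(a <- s) psum rat d a * \prod_(b <- s') hsym rat d b).
Proof.
elim: {s}_.+1 {-2}s s' (ltnSn (sumn s)) => // k IH [|a s] s'.
  by move=> _ _ sum_s'; rewrite big_nil mul1r; apply: W_hsym.
case: a => // a; rewrite ltnS /= => sum_s pos_s le_d.
have := newton_hsym rat d a.+1; rewrite big_ord_recr /= subnn hsym0 mulr1 => newton.
rewrite big_cons -[psum _ _ _](addKr (\sum_(i < a) psum rat d i.+1 * hsym rat d (a.+1 - i.+1))).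
rewrite -newton -mulrA mulrDl mulNr -scaleN1r; apply: WD.
  apply: WZ; rewrite mulr_suml; apply: W_sum => i _.
  have := IH (i.+1 :: s) (a.+1 - i.+1 :: s')%N; rewrite !big_cons /= => W_i.
  rewrite [X in W X](_ : _ = psum rat d i.+1 * \prod_(j <- s) psum rat d j *
      (hsym rat d (a.+1 - i.+1) * \prod_(j <- s') hsym rat d j)); last by ring.
  by apply: W_i => //; have := ltn_ord i; lia.
rewrite -scalerAl; apply: WZ.
have := IH s (a.+1 :: s'); rewrite big_cons /= => W_s.
rewrite [X in W X](_ : _ = \prod_(j <- s) psum rat d j *
  (hsym rat d a.+1 * \prod_(j <- s') hsym rat d j)); last by ring.
by apply: W_s => //; lia.
Qed.

End Kernel.

(** * The transition matrix *)

Lemma prod_psum (R : comNzRingType) (n : nat) (s : seq nat) :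
  \prod_(a <- s) psum R n a =
  \sum_(f : {ffun 'I_(size s) -> 'I_n}) 'X_[\sum_(i < size s) U_(f i) *+ nth 0%N s i].
Proof.
rewrite (big_nth 0%N) big_mkord bigA_distr_bigA; apply: eq_bigr => f _.
by rewrite -mprodXE; apply: eq_bigr => i _; rewrite mpolyXn.
Qed.

(** Triangularity: a monomial of p_nu comes from sending each part of [nu] to a variable. If the
    exponent is [rho], all of its [size rho] variables are hit, so with [size nu <= size rho] no two
    parts share a variable and [rho] rearranges [nu]. *)
Lemma mnm_of_sum_eq (d : nat) (nu rho : intpart) (f : 'I_(size nu) -> 'I_d) :
    (size rho <= d)%N -> (size nu <= size rho)%N ->
    (\sum_(i < size nu) U_(f i) *+ nth 0%N nu i)%MM = mnm_of d rho ->
  rho = nu.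
Proof.
move=> rho_d nu_rho def_rho.
have rhoE (j : 'I_d) : nth 0%N rho j = (\sum_(i < size nu | f i == j) nth 0%N nu i)%N.
  have := congr1 (fun m : 'X_{1..d} => m j) def_rho; rewrite /= mnmE => <-.
  rewrite mnm_sumE [RHS]big_mkcond; apply: eq_bigr => i _.
  by rewrite mulmnE mnm1E; case: eqP; rewrite ?mul1n.
pose s2 := [seq val (f i) | i : 'I_(size nu)].
have sub : {subset iota 0 (size rho) <= s2}.
  move=> j; rewrite mem_iota add0n => /= lt_j.
  have := is_part_nth_gt0 lt_j; have j_d := leq_trans lt_j rho_d.
  rewrite -[j]/(val (Ordinal j_d)) rhoE lt0n sum_nat_eq0 negb_forall => /existsP[i].
  rewrite negb_imply => /andP[/eqP <- _]; exact: image_f.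
have size2 : (size s2 <= size (iota 0 (size rho)))%N by rewrite size_iota size_image card_ord.
have uniq2 := leq_size_uniq (iota_uniq 0 (size rho)) sub size2.
have [_ eq12] := uniq_min_size (iota_uniq 0 (size rho)) sub size2.
have f_inj : injective f.
  have /injectiveP val_f_inj : injectiveb (fun i => val (f i)) by [].
  by move=> i i' eq_f; apply: val_f_inj; rewrite /= eq_f.
apply: part_eq; rewrite -[X in perm_eq X _](mkseq_nth 0%N) /mkseq.
have pe : perm_eq (iota 0 (size rho)) s2 by apply: uniq_perm (iota_uniq _ _) uniq2 eq12.
apply: perm_trans (perm_map _ pe) _; rewrite -map_comp.
rewrite -[X in perm_eq _ X](mkseq_nth 0%N) /mkseq -val_enum_ord -map_comp.
apply/seq.permP => a; congr count; apply: eq_map => i /=.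
by rewrite rhoE (eq_bigl (fun i' => i' == i)) ?big_pred1_eq // => i'; rewrite (inj_eq f_inj).
Qed.

(** The coefficient counts assignments of parts to variables; sending the i-th part to the i-th
    variable is one of them. *)
Lemma mcoeff_prod_psum_diag (d : nat) (nu : intpart) : (size nu <= d)%N ->
  (\prod_(a <- nu) psum rat d a)@_(mnm_of d nu) != 0.
Proof.
move=> nu_d; rewrite prod_psum raddf_sum /=; under eq_bigr do rewrite mcoeffX.
rewrite -natr_sum pnatr_eq0 -lt0n lt0n sum_nat_eq0 negb_forall.
apply/existsP; exists [ffun i => widen_ord nu_d i]; rewrite /= eqb0 negbK; apply/eqP/mnmP => j.
rewrite mnm_sumE mnmE; under eq_bigr do rewrite mulmnE mnm1E ffunE.
have [lt_j|le_j] := ltnP j (size nu).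
  rewrite (bigD1 (Ordinal lt_j)) //= big1 => [|i ij].
    by rewrite -val_eqE /= eqxx mul1n addn0.
  by rewrite -val_eqE /= (_ : (i == j :> nat) = false) //; apply: negbTE; rewrite -val_eqE in ij.
rewrite nth_default // big1 // => i _; rewrite -val_eqE /=.
by rewrite (_ : (i == j :> nat) = false) //; have := ltn_ord i; lia.
Qed.

Section Matrix.

Variable d : nat.

Let N := size (parts_le d).
Let la (i : nat) : intpart := nth empty_part (parts_le d) i.

Let columns (mu : intpart) (i : 'I_(head 0%N mu)) := column (conj_part mu i).

Lemma nth_parts_le (i : 'I_N) : (sumn (la i) <= d)%N.
Proof. by rewrite -mem_parts_le mem_nth. Qed.

Lemma parts_le_surj (mu : intpart) : (sumn mu <= d)%N -> exists i : 'I_N, la i = mu.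
Proof.
rewrite -mem_parts_le => mu_d; have lt_mu : (index mu (parts_le d) < N)%N by rewrite index_mem.
by exists (Ordinal lt_mu); rewrite /la nth_index.
Qed.

Lemma parts_le_inj (i j : 'I_N) : la i = la j -> i = j.
Proof. by move/eqP; rewrite nth_uniq ?parts_le_uniq // => /eqP/val_inj. Qed.

(** Coordinates of the raw cumulants on the monomial functions of degree at most [d], over any ring
    so that the matrix can be specialised. *)
Definition cumulant_mx (R : comNzRingType) (q t : R) : 'M[R]_N :=
  \matrix_(i, j) (raw_cumulant q%:MP t%:MP (fun k : 'I_d => 'X_k) (@columns (la i)))
    @_(mnm_of d (la j)).

Lemma map_cumulant_mx (R S : comNzRingType) (f : {rmorphism R -> S}) (q t : R) :
  map_mx f (cumulant_mx q t) = cumulant_mx (f q) (f t).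
Proof.
apply/matrixP => i j; rewrite !mxE -mcoeff_map_mpoly.
rewrite (rmorph_raw_cumulant (map_mpoly f : {rmorphism _ -> _})) /= !map_mpolyC.
by congr (_@__); apply: eq_raw_cumulant => k; rewrite /= map_mpolyX.
Qed.

(** A kernel vector [v] of the transpose is a linear form [phi] killing the cumulants, hence all
    products of power sums of degree at most [d]. *)
Lemma cumulant_mx00_unit : cumulant_mx (0 : rat) 0 \in unitmx.
Proof.
rewrite -unitmx_tr -row_free_unit; apply: inj_row_free => v v0.
pose phi (p : {mpoly rat[d]}) := \sum_(j < N) v 0 j * p@_(mnm_of d (la j)).
have phi_cumulant (mu : intpart) : (sumn mu <= d)%N ->
    phi (raw_cumulant 0 0 (fun k : 'I_d => 'X_k) (@columns mu)) = 0.
  move=> /parts_le_surj[i <-]; have /rowP/(_ i) := v0; rewrite !mxE => v0i.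
  by rewrite -[RHS]v0i; apply: eq_bigr => j _; rewrite !mxE mpolyC0.
have phi0 : phi 0 = 0 by rewrite /phi big1 // => j _; rewrite mcoeff0 mulr0.
have phiD p p' : phi p = 0 -> phi p' = 0 -> phi (p + p') = 0.
  move=> p0 p'0; rewrite -[RHS]addr0 -{1}p0 -p'0 -big_split; apply: eq_bigr => j _.
  by rewrite mcoeffD mulrDr.
have phiZ c p : phi p = 0 -> phi (c *: p) = 0.
  move=> p0; rewrite -[RHS](mulr0 c) -p0 mulr_sumr; apply: eq_bigr => j _.
  by rewrite mcoeffZ mulrCA.
apply/eqP/negPn/negP => /rV0Pn[j0 vj0].
(* With [la j] of fewest parts among the nonzero coordinates, triangularity leaves only the diagonal
   term in the value of [phi] on the product of power sums indexed by [la j], which must be 0. *)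
pose j := [arg min_(j < j0 | v 0 j != 0) size (la j)].
have [vj j_min] : v 0 j != 0 /\ forall j', v 0 j' != 0 -> (size (la j) <= size (la j'))%N.
  by rewrite /j; case: arg_minnP => // j1 ? j1_min; split.
have pos : all (fun a => 0 < a)%N (la j).
  by apply/(all_nthP 0%N) => i; apply: is_part_nth_gt0.
have := W_psum phi0 phiD phiZ phi_cumulant (s' := [::]) pos.
rewrite addn0 big_nil mulr1 => /(_ (nth_parts_le j)); apply/eqP.
rewrite /phi (bigD1 j) //= [X in _ + X]big1 ?addr0; last first.
  move=> i ij; have [->|vi] := eqVneq (v 0 i) 0; first by rewrite mul0r.
  rewrite prod_psum raddf_sum /= big1 ?mulr0 // => f _; rewrite mcoeffX.
  case: eqP => // /mnm_of_sum_eq eq_la; case/eqP: ij; apply: parts_le_inj; apply: eq_la.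
    exact: leq_trans (size_part _) (nth_parts_le i).
  exact: j_min.
rewrite mulf_neq0 // mcoeff_prod_psum_diag //.
exact: leq_trans (size_part _) (nth_parts_le j).
Qed.

Lemma cumulant_mx_unit : cumulant_mx qvar tvar \in unitmx.
Proof.
(* [A] has entries in Q[q, t]; its determinant maps both to the one over Q(q, t) and to the one at
   the origin. *)
pose A := cumulant_mx ('X_ord0 : {mpoly rat[2]}) 'X_ord_max.
have -> : cumulant_mx qvar tvar = map_mx (@FracField.tofrac {mpoly rat[2]}) A.
  by rewrite map_cumulant_mx.
rewrite unitmxE det_map_mx unitfE tofrac_eq0; apply: contraTneq cumulant_mx00_unit => det0.
have -> : cumulant_mx 0 0 = map_mx (meval (fun=> 0 : rat)) A.
  by rewrite map_cumulant_mx /= !mevalXU.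
by rewrite unitmxE det_map_mx det0 rmorph0 unitr0.
Qed.

Definition cumulant_factor (mu : intpart) : Qqt := (qvar - 1) ^- (head 0%N mu).-1.

Lemma cumulant_factor_neq0 (mu : intpart) : cumulant_factor mu != 0.
Proof. by rewrite invr_eq0 expf_neq0 // qvar1_neq0. Qed.

Lemma mcoeff_colored (i j : 'I_N) :
  (colored_macdonald (la i) d)@_(mnm_of d (la j)) =
  cumulant_factor (la i) * cumulant_mx qvar tvar i j.
Proof. by rewrite /colored_macdonald cumulantE mcoeffZ mxE. Qed.

Lemma colored_free_le (c : intpart -> Qqt) :
    \sum_(mu <- parts_le d) c mu *: colored_macdonald mu d = 0 ->
  forall mu : intpart, (sumn mu <= d)%N -> c mu = 0.
Proof.
move=> lin0 _ /parts_le_surj[i <-].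
(* Absorbing the nonzero powers of q - 1 into the coefficients makes the relation a row vector
   killed by the invertible matrix. *)
pose v : 'rV[Qqt]_N := \row_i (c (la i) * cumulant_factor (la i)).
have v0 : v *m cumulant_mx qvar tvar = 0.
  apply/rowP => j; rewrite !mxE -[RHS](mcoeff0 _ (mnm_of d (la j))) -lin0.
  rewrite raddf_sum /= (big_nth empty_part) big_mkord; apply: eq_bigr => k _.
  by rewrite mcoeffZ mcoeff_colored mxE mulrA.
have /rowP/(_ i) : v = 0 by rewrite -(mulmxK cumulant_mx_unit v) v0 mul0mx.
by rewrite !mxE => /eqP; rewrite mulf_eq0 (negbTE (cumulant_factor_neq0 _)) orbF => /eqP.
Qed.

(** The coefficients solve the linear system in [d] variables; [symfun_le_eq0] then carries the
    equality over to every number of variables. *)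
Lemma colored_span_le (f : pseries) : symfun_le d f -> exists c : intpart -> Qqt,
  forall n, f n = lincomb colored_macdonald c (parts_le d) n.
Proof.
move=> Ff.
pose u : 'rV[Qqt]_N := \row_j (f d)@_(mnm_of d (la j)).
pose w := u *m invmx (cumulant_mx qvar tvar).
pose c (mu : intpart) := oapp (fun i : 'I_N => w 0 i / cumulant_factor mu) 0
  (insub (index mu (parts_le d))).
have cE (i : 'I_N) : c (la i) = w 0 i / cumulant_factor (la i).
  by rewrite /c index_uniq ?parts_le_uniq // valK.
exists c => n; apply/eqP; rewrite -subr_eq0 -scaleN1r; apply/eqP; move: n.
apply: (@symfun_le_eq0 d).
  apply: symfun_leD Ff (symfun_leZ _ _).
  have symF mu : mu \in parts_le d -> symfun_le d (fun n => c mu *: colored_macdonald mu n).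
    by rewrite mem_parts_le => le_d; apply/symfun_leZ/(symfun_leT le_d)/colored_symfun_le.
  apply: (@symfun_le_ext _ (fun n => \sum_(mu <- parts_le d | mu \in parts_le d)
    c mu *: colored_macdonald mu n)).
    by move=> n; rewrite /lincomb -big_seq.
  exact: symfun_le_sum.
move=> _ /parts_le_surj[j <-]; rewrite mcoeffD mcoeffZ mulN1r.
have := congr1 (fun x : 'rV__ => x 0 j) (mulmxKV cumulant_mx_unit u).
rewrite !mxE => <-; rewrite /lincomb raddf_sum /= (big_nth empty_part) big_mkord.
apply/eqP; rewrite subr_eq0; apply/eqP; apply: eq_bigr => i _.
rewrite mcoeffZ mcoeff_colored cE mulrA divfK ?cumulant_factor_neq0 //.
Qed.

End Matrix.

Theorem theorem7p2 : linear_basis symfun colored_macdonald.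
Proof.
split=> [mu|s c s_uniq lin0 mu mu_s|f [f_sym f_kill [d f_d]]].
- exact: symfun_leW (colored_symfun_le mu).
- pose d := (\max_(nu <- s) sumn nu)%N.
  have le_d (nu : intpart) : nu \in s -> (sumn nu <= d)%N.
    move=> nu_s; rewrite /d.
    exact: (leq_bigmax_seq (F := fun nu : intpart => sumn nu) nu nu_s isT).
  (* The relation is extended by zero to all partitions of size at most [d]. *)
  pose c' nu := if nu \in s then c nu else 0.
  have -> : c mu = c' mu by rewrite /c' mu_s.
  apply: (@colored_free_le d) (le_d _ mu_s); rewrite -[RHS](lin0 d) /lincomb.
  rewrite (eq_bigr (fun nu => if nu \in s then c nu *: colored_macdonald nu d else 0)); last first.
    by move=> nu _; rewrite /c'; case: ifP => // _; rewrite scale0r.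
  rewrite -big_mkcond -big_filter; apply: perm_big; apply: uniq_perm => //.
    by rewrite filter_uniq // parts_le_uniq.
  by move=> nu; rewrite mem_filter mem_parts_le; apply: andb_idr => /le_d.
- have Ff : symfun_le d f by split=> // n; apply: leq_trans (f_d n) (leqnSn d).
  by have [c fE] := colored_span_le Ff; exists (parts_le d), c.
Qed.
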